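(* Let $m\ge2$ be an integer and $w$ an infinite periodic or Sturmian word over $\{0,1\}$ with slope $\pi(w)=\alpha$. Let $A=A(m,w)=A_0\oplus A_1$ be a $\mathbb{Z}_2$-grading on $A$ such that the generators $a,b,z_1^{(1)}$ are homogeneous. Then $\exp^{gr}(A)$ exists and $$\exp^{gr}(A)=\exp(A)=\Phi\Big(\frac1{m+\alpha}\Big),\qquad \Phi(x)=\frac{1}{x^x(1-x)^{1-x}}.$$ Moreover, if $A^\#$ is obtained from $A$ by adjoining an external unit, with the induced $\mathbb{Z}_2$-grading, then $\exp^{gr}(A^\#)$ exists and $\exp^{gr}(A^\#)=\exp^{gr}(A)+1$.
   Context: $F$ is a field of characteristic zero. $A(m,w)$: basis $\{a,b,z_j^{(i)}: i\ge1,1\le j\le m+w_i\}$, products $z_j^{(i)}a=z_{j+1}^{(i)}$ for $j<m+w_i$, $z_{m+w_i}^{(i)}b=z_1^{(i+1)}$, all other products zero; it is generated by $z_1^{(1)},a,b$. A word is Sturmian if it has exactly $n+1$ distinct subwords of length $n$ for all $n\ge1$; slope $\pi(w)=\lim_n (w_1+\dots+w_n)/n$. $\exp(A)=\lim\sqrt[n]{c_n(A)}$ for ordinary codimensions $c_n$. $A^\#=A\oplus F1$ with external unit $1$, graded by $A_0^\#=A_0\oplus F1$, $A_1^\#=A_1$. Graded codimension $c_n^{gr}(B)=\sum_k\binom nk c_{k,n-k}(B)$ where $c_{k,n-k}(B)$ is the dimension of the space of polynomials multilinear in even variables $x_1..x_k$ and odd variables $y_1..y_{n-k}$ modulo graded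 identities of $B$; $\exp^{gr}(B)=\lim\sqrt[n]{c_n^{gr}(B)}$. *)

(* Defs.v *)
From Stdlib Require Import Reals.
From HB Require Import structures.
From mathcomp Require Import all_boot all_order all_algebra.
Set Implicit Arguments. Unset Strict Implicit. Unset Printing Implicit Defensive.
Import GRing.Theory.

(* Algebras given by a basis T and a "monomial" multiplication table  *)
(* mt : T -> T -> option T (product of two basis vectors is a basis   *)
(* vector or 0).  Elements are finite formal linear combinations      *)
(* seq (F * T); two combinations denote the same vector iff all their *)
(* coordinates agree.                                                 *)
Section BasisAlgebra.
Local Open Scope ring_scope.
Variables (F : fieldType) (T : eqType) (mt : T -> T -> option T).

Definition elem := seq (F * T).

Definition coefv (u : elem) (t : T) : F := \sum_(p <- u | p.2 == t) p.1.
Definition is_zero (u : elem) : Prop := forall t, coefv u t = 0.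
Definition equiv (u v : elem) : Prop := forall t, coefv u t = coefv v t.

Definition addv (u v : elem) : elem := u ++ v.
Definition scalev (c : F) (u : elem) : elem := [seq (c * q.1, q.2) | q <- u].
Definition mul_term (p q : F * T) : elem :=
  if mt p.2 q.2 is Some r then [:: (p.1 * q.1, r)] else [::].
Definition mulv (u v : elem) : elem :=
  flatten [seq flatten [seq mul_term p q | q <- v] | p <- u].

Definition subspace (P : elem -> Prop) : Prop :=
  [/\ forall u v, equiv u v -> P u -> P v,
      P [::],
      forall u v, P u -> P v -> P (addv u v) &
      forall c u, P u -> P (scalev c u)].

Definition is_grading (P0 P1 : elem -> Prop) : Prop :=
  [/\ subspace P0, subspace P1,
      (forall u, exists u0 u1, [/\ P0 u0, P1 u1 & equiv u (addv u0 u1)]),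
      (forall u, P0 u -> P1 u -> is_zero u) &
      [/\ forall u v, P0 u -> P0 v -> P0 (mulv u v),
          forall u v, P0 u -> P1 v -> P1 (mulv u v),
          forall u v, P1 u -> P0 v -> P1 (mulv u v) &
          forall u v, P1 u -> P1 v -> P0 (mulv u v)]].

Definition homogeneous (P0 P1 : elem -> Prop) (u : elem) : Prop := P0 u \/ P1 u.

(* monomials: binary bracketings of variables x_i (i : nat, 0-based) *)
Inductive mono := MV of nat | MM of mono & mono.

Fixpoint leaves (t : mono) : seq nat :=
  match t with MV i => [:: i] | MM l r => leaves l ++ leaves r end.

Definition multilin (n : nat) (t : mono) : bool := perm_eq (leaves t) (iota 0 n).

Definition poly := seq (F * mono).
Definition in_Pn (n : nat) (p : poly) : bool := all (fun ct => multilin n ct.2) p.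

Fixpoint evalm (s : nat -> elem) (t : mono) : elem :=
  match t with MV i => s i | MM l r => mulv (evalm s l) (evalm s r) end.
Definition evalp (s : nat -> elem) (p : poly) : elem :=
  flatten [seq scalev ct.1 (evalm s ct.2) | ct <- p].

Definition is_id (Q : (nat -> elem) -> Prop) (p : poly) : Prop :=
  forall s, Q s -> is_zero (evalp s p).

Definition scalep (c : F) (p : poly) : poly := [seq (c * ct.1, ct.2) | ct <- p].
Definition lincomb (lam : nat -> F) (ps : seq poly) : poly :=
  flatten [seq scalep (lam i) (nth [::] ps i) | i <- iota 0 (size ps)].

Definition indep_mod (n : nat) (Q : (nat -> elem) -> Prop) (ps : seq poly) : Prop :=
  all (in_Pn n) ps /\
  forall lam : nat -> F, is_id Q (lincomb lam ps) -> forall i : nat, (i < size ps)%N -> lam i = 0.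

(* d = dim P_n / (P_n \cap Id_Q) *)
Definition dim_mod (n : nat) (Q : (nat -> elem) -> Prop) (d : nat) : Prop :=
  (exists ps, size ps = d /\ indep_mod n Q ps) /\
  (forall ps, indep_mod n Q ps -> (size ps <= d)%N).

Definition codim (n d : nat) : Prop := dim_mod n (fun _ => True) d.

Definition graded_subst (P0 P1 : elem -> Prop) (k n : nat) (s : nat -> elem) : Prop :=
  forall i, ((i < k)%N -> P0 (s i)) /\ ((k <= i < n)%N -> P1 (s i)).

Definition gcodim_kn (P0 P1 : elem -> Prop) (k n d : nat) : Prop :=
  dim_mod n (graded_subst P0 P1 k n) d.

Definition gcodim (P0 P1 : elem -> Prop) (n d : nat) : Prop :=
  exists f : nat -> nat,
    (forall k, (k <= n)%N -> gcodim_kn P0 P1 k n (f k)) /\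
    d = (\sum_(k < n.+1) 'C(n, k) * f k)%N.

End BasisAlgebra.

Section RealPart.
Local Open Scope R_scope.

Definition nroot (n c : nat) : R :=
  if c is 0 then 0 else Rpower (INR c) (/ INR n).

Definition has_exp (cod : nat -> nat -> Prop) (L : R) : Prop :=
  exists c : nat -> nat, (forall n, cod n (c n)) /\ Un_cv (fun n => nroot n (c n)) L.

Definition Phi (x : R) : R := / (Rpower x x * Rpower (1 - x) (1 - x)).

Definition factor (w : nat -> bool) (i n : nat) : seq bool := [seq w (i + j)%nat | j <- iota 0 n].

Definition periodic (w : nat -> bool) : Prop :=
  exists p, (0 < p)%nat /\ forall i, w (i + p)%nat = w i.

Definition sturmian (w : nat -> bool) : Prop :=
  forall n, (1 <= n)%nat -> exists s : seq (seq bool),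
    [/\ size s = n.+1, uniq s,
        (forall i, factor w i n \in s) &
        (forall u, u \in s -> exists i, factor w i n = u)].

Definition slope (w : nat -> bool) (alpha : R) : Prop :=
  Un_cv (fun n => sum_f_R0 (fun i => if w i then 1 else 0) n / INR n.+1) alpha.

End RealPart.

(* raw basis: inl false = a, inl true = b, inr (i,j) = z_j^{(i)}.     *)
(* The word letters are w_1 w_2 ... = w 0, w 1, ..., i.e. w_i = w (i-1)*)
Definition rawB := (bool + (nat * nat))%type.

Definition weight (w : nat -> bool) (i : nat) : nat := w i.-1.

Definition validb (m : nat) (w : nat -> bool) (x : rawB) : bool :=
  match x with
  | inl _ => true
  | inr (i, j) => [&& 1 <= i, 1 <= j & j <= m + weight w i]
  end.

Definition rawmul (m : nat) (w : nat -> bool) (x y : rawB) : option rawB :=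
  match x, y with
  | inr (i, j), inl false => if j < m + weight w i then Some (inr (i, j.+1)) else None
  | inr (i, j), inl true => if j == m + weight w i then Some (inr (i.+1, 1)) else None
  | _, _ => None
  end.

Definition BA (m : nat) (w : nat -> bool) := {x : rawB | validb m w x}.

Definition mulAmw (m : nat) (w : nat -> bool) (x y : BA m w) : option (BA m w) :=
  obind (fun r => @insub _ (validb m w) (BA m w) r) (rawmul m w (val x) (val y)).

Definition basis_elem (F : fieldType) (m : nat) (w : nat -> bool) (r : rawB)
  : elem F (BA m w) :=
  if @insub _ (validb m w) (BA m w) r is Some x then [:: (1%R, x)] else [::].

Definition gen_a F m w := @basis_elem F m w (inl false).
Definition gen_b F m w := @basis_elem F m w (inl true).
Definition gen_z F m w := @basis_elem F m w (inr (1, 1)%nat).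

(* A^# = A (+) F1 : basis option (BA m w), None = external unit 1 *)
Definition mulAsharp (m : nat) (w : nat -> bool) (x y : option (BA m w))
  : option (option (BA m w)) :=
  match x, y with
  | None, _ => Some y
  | _, None => Some x
  | Some x', Some y' => omap Some (mulAmw x' y')
  end.

Definition embedA (F : fieldType) (T : eqType) (u : elem F T) : elem F (option T) :=
  [seq (q.1, Some q.2) | q <- u].

Definition gradeS0 (F : fieldType) (T : eqType) (P0 : elem F T -> Prop)
  (x : elem F (option T)) : Prop :=
  exists u c, P0 u /\ equiv x (embedA u ++ [:: (c, None)]).
Definition gradeS1 (F : fieldType) (T : eqType) (P1 : elem F T -> Prop)
  (x : elem F (option T)) : Prop :=
  exists u, P1 u /\ equiv x (embedA u).

(* Main.v *)
(* Index the z's along the chain as z_0, z_1, ...; then z_p x = z_(p+1) for exactly one generator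
   x = U_p, where U is the word a^(m+w_1-1) b a^(m+w_2-1) b ... A multilinear polynomial is an identity iff it
   vanishes on substitutions of basis vectors, and the homogeneity of a, b, z_0 makes the whole basis homogeneous.
   Such a substitution contributes a functional determined by the role (unit, a, b or z) of every variable and by
   the factor of U read from the z on; it vanishes unless that factor has as many b's as there are variables in
   the role b. As U has polynomially many factors, and any of its factors of length N has about N / (m + alpha)
   letters b (periodic and Sturmian words are balanced up to a constant), counting the admissible role assignments
   bounds the codimensions from above, by a weighted Chernoff-type count. For the lower bound keep only the
   prefixes of U: the left-normed monomials, and in A^# the products of iterated associators with the variables in
   the role of the unit, are dual in a triangular way to these functionals. The binomial weights in the graded
   codimension exactly account for the choice of the parity pattern, which is determined by the roles, so the
   ordinary and the graded sequences have the same growth, and units turn l^n into (1 + l)^n. *)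
Require Import Defs.
From Stdlib Require Import Reals.
From HB Require Import structures.
From mathcomp Require Import all_boot all_order all_algebra.
From Stdlib Require Import Lra.
From mathcomp Require Import all_fingroup boolp Rstruct zify.
Set Implicit Arguments. Unset Strict Implicit. Unset Printing Implicit Defensive.
Import Order.TTheory GRing.Theory Num.Theory.

(** * Balance of Sturmian words *)

(** Sturmian words are given by their complexity, so balance has to be derived from it: a shortest
    unbalanced pair of windows has the form [1 l 1], [0 l 0] with [l] a palindrome, and this
    contradicts the uniqueness of the factor with two right extensions. With a unit, left-normed
    monomials are not enough for the lower bound: they may survive when further variables become
    units, so they do not detect which variables are non-units. An associator vanishes as soon as
    one entry is a unit, hence iterated associators do detect them. Each associator consumes two
    variables besides the z, so only configurations with an odd number of non-units, at least three,
    are tested; restricting to even numbers of generators costs a constant factor. The parity of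
    [z_p] depends on [p], which a role forgets. Since at most one z occurs in a surviving
    substitution, the upper bound allows both parities and loses a factor 2, while the lower bound
    only ever substitutes [z_0]. *)

Definition wcount (w : nat -> bool) (i n : nat) : nat := \sum_(0 <= k < n) w (i + k).

Lemma wcountS w i n : wcount w i n.+1 = wcount w i n + w (i + n).
Proof. by rewrite /wcount big_nat_recr. Qed.

Lemma wcount0 w i : wcount w i 0 = 0.
Proof. by rewrite /wcount big_geq. Qed.

Lemma wcountD w i a b : wcount w i (a + b) = wcount w i a + wcount w (i + a) b.
Proof.
by elim: b => [|b IH]; rewrite ?wcount0 ?addn0 // addnS !wcountS IH -!addnA.
Qed.

Lemma wcountSl w i n : wcount w i n.+1 = w i + wcount w i.+1 n.
Proof. by rewrite -add1n wcountD wcountS wcount0 add0n addn0 addn1. Qed.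

Lemma wcount_le w i n : wcount w i n <= n.
Proof. elim: n => [|n IH]; rewrite ?wcount0 // wcountS; case: (w _); lia. Qed.

Lemma eq_wcount w w' i j n :
  (forall k, k < n -> w (i + k) = w' (j + k)) -> wcount w i n = wcount w' j n.
Proof. by move=> h; apply: eq_big_nat => k /andP[_ /h ->]. Qed.

Lemma size_factor w i n : size (factor w i n) = n.
Proof. by rewrite size_map size_iota. Qed.

Lemma nth_factor w i n k : k < n -> nth false (factor w i n) k = w (i + k).
Proof. by move=> h; rewrite (nth_map 0) ?size_iota // nth_iota. Qed.

Lemma eq_factor w w' i j n :
  factor w i n = factor w' j n <-> (forall k, k < n -> w (i + k) = w' (j + k)).
Proof.
split=> [h k hk|h]; first by rewrite -(nth_factor w i hk) h nth_factor.
apply: (@eq_from_nth _ false); rewrite !size_factor // => k hk.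
by rewrite !nth_factor // h.
Qed.

Lemma factorS w i n : factor w i n.+1 = rcons (factor w i n) (w (i + n)).
Proof. by rewrite /factor -addn1 iotaD map_cat cats1. Qed.

Lemma factorSl w i n : factor w i n.+1 = w i :: factor w i.+1 n.
Proof.
rewrite /factor /= addn0; congr cons; rewrite (iotaDl 1 0) -map_comp.
by apply: eq_map => k /=; rewrite addnA addn1.
Qed.

Lemma special_unique w (hw : sturmian w) n i j i' j' :
  factor w i n = factor w j n -> w (i + n) != w (j + n) ->
  factor w i' n = factor w j' n -> w (i' + n) != w (j' + n) ->
  factor w i n = factor w i' n.
Proof.
case: n => [//|n] eij dij eij' dij'.
have [s [ss us ms es]] := hw n.+1 isT.
have [t [st ut mt et]] := hw n.+2 isT.
have /choice[e he] : forall z, exists b, z \in s -> rcons z b \in t.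
  move=> z; case: (boolP (z \in s)) => [/es[k <-]|_]; last by exists true.
  by exists (w (k + n.+1)); rewrite -factorS.
have both x y b : factor w x n.+1 = factor w y n.+1 ->
    w (x + n.+1) != w (y + n.+1) -> rcons (factor w x n.+1) b \in t.
  move=> exy dxy; case: (eqVneq b (w (x + n.+1))) => [->|hb].
    by rewrite -factorS.
  have -> : b = w (y + n.+1) by case: b (w _) (w _) hb dxy => [] [] [].
  by rewrite exy -factorS.
apply/eqP; apply: contraT => hne.
set x := factor w i n.+1 in hne *; set y := factor w i' n.+1 in hne *.
pose L := [:: rcons x (~~ e x), rcons y (~~ e y) & [seq rcons z (e z) | z <- s]].
have nx v : rcons v (~~ e v) \notin [seq rcons z (e z) | z <- s].
  apply/mapP => -[z _] /rcons_inj[-> ]; by case: (e z).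
have uL : uniq L.
  have um : uniq [seq rcons z (e z) | z <- s].
    by rewrite map_inj_uniq // => z z' /rcons_inj[].
  rewrite !cons_uniq um (nx y) in_cons negb_or (nx x) !andbT.
  by apply: contra hne => /eqP/rcons_inj/(congr1 fst) h; apply/eqP.
have sL : {subset L <= t}.
  move=> v; rewrite !inE => /or3P[/eqP->|/eqP->|/mapP[z hz ->]].
  - exact: both eij dij.
  - exact: both eij' dij'.
  - exact: he.
have := uniq_leq_size uL sL; rewrite /= size_map ss st; lia.
Qed.

(* A window [c l c] of a Sturmian word whose prefix [c l] is never followed by [~~ c] would make the word
   eventually periodic: among the windows of length [|l| + 1] starting inside the next [|l| + 2] positions none
   is the special one [~~ c l] (here [l] is a palindrome), so two coincide and determine each other's future. *)
Lemma sturmian_no_run w (hw : sturmian w) c q i j :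
  w i = c -> w (i + q.+1) = c -> w j = ~~ c -> w (j + q.+1) = ~~ c ->
  (forall k, 1 <= k <= q -> w (i + k) = w (j + k)) ->
  (forall k, 1 <= k <= q -> w (i + k) = w (i + (q.+1 - k))) ->
  (forall x, factor w x q.+1 = factor w i q.+1 -> w (x + q.+1) = c) -> False.
Proof.
move=> wi wiN wj wjN eij pal det.
have spec x y : factor w x q.+1 = factor w y q.+1 -> w (x + q.+1) != w (y + q.+1) ->
    factor w x q.+1 = factor w j q.+1.
  move=> exy dxy.
  have exi : factor w x.+1 q = factor w i.+1 q.
    apply: (@special_unique w hw q x.+1 y.+1 i.+1 j.+1).
    - by move: exy; rewrite !factorSl => -[].
    - by rewrite !addSn -!addnS.
    - by apply/eq_factor => k hk; rewrite !addSn -!addnS; apply: eij; lia.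
    - by rewrite !addSn -!addnS wiN wjN; case: (c).
  case: (eqVneq (w x) c) => hx.
    have e : factor w x q.+1 = factor w i q.+1 by rewrite !factorSl exi hx wi.
    by move: dxy; rewrite !det ?eqxx // -exy.
  rewrite !factorSl exi wj; congr cons; first by case: (w x) (c) hx => [] [].
  by apply/eq_factor => k hk; rewrite !addSn -!addnS; apply: eij; lia.
(* For positive [k], such an occurrence puts [~~ c] at [i + k]. It also covers [i + q.+1], which
   carries [c], and by the palindrome property the letter it prescribes there is the one at
   [i + k]. *)
have avoid k : k <= q.+1 -> factor w (i + k) q.+1 <> factor w j q.+1.
  move=> hk /eq_factor h; case: k hk h => [_ /(_ 0 isT)|k hk h].
    by rewrite !addn0 wi wj; case: (c).
  have h0 : w (i + k.+1) = ~~ c by have := h 0 isT; rewrite !addn0 wj.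
  case: (eqVneq k q) => [hkq|/eqP hkq].
    by move: h0; rewrite hkq wiN; case: (c).
  have := h (q - k); have -> : i + k.+1 + (q - k) = i + q.+1 by lia.
  rewrite wiN -eij; last lia.
  rewrite pal; last lia.
  have -> : i + (q.+1 - (q - k)) = i + k.+1 by lia.
  by rewrite h0 => /(_ ltac:(lia)); case: (c).
have [s [ss us ms es]] := hw q.+1 isT.
have [a [b [hab hb eab]]] : exists a b, [/\ a < b, b <= q.+1 &
    factor w (i + a) q.+1 = factor w (i + b) q.+1].
  pose L := [seq factor w (i + k) q.+1 | k <- iota 0 q.+2].
  have nu : ~~ uniq L.
    apply/negP => uL.
    have : uniq (factor w j q.+1 :: L).
      rewrite cons_uniq uL andbT; apply/mapP => -[k].
      by rewrite mem_iota => hk /esym; apply: avoid; lia.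
    have sub : {subset factor w j q.+1 :: L <= s}.
      by move=> v; rewrite inE => /orP[/eqP->|/mapP[k _ ->]].
    by move=> /uniq_leq_size /(_ sub); rewrite /= !size_map size_iota ss ltnn.
  move: nu => /(uniqPn [::])[a [b [hab]]]; rewrite size_map size_iota => hb.
  rewrite !(nth_map 0) ?size_iota ?nth_iota //; try lia.
  by rewrite !add0n => e; exists a, b.
have per k : w (i + a + k) = w (i + b + k).
  elim/ltn_ind: k => k IH.
  case: (ltnP k q.+1) => hk; first by move/eq_factor: eab => /(_ k hk).
  (* The part already known to be periodic carries every later window back, by steps of [b - a], to
     the range treated by [avoid]. *)
  have free t : t <= k - q.+1 -> factor w (i + a + t) q.+1 <> factor w j q.+1.
    elim/ltn_ind: t => t IHt ht.
    case: (leqP t (b - a)) => htd; first by rewrite -addnA; apply: avoid; lia.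
    have <- : factor w (i + a + (t - (b - a))) q.+1 = factor w (i + a + t) q.+1.
      apply/eq_factor => x hx; rewrite -addnA IH; last lia.
      by congr w; lia.
    by apply: IHt; lia.
  apply/eqP; apply: contraT => hne; case: (free (k - q.+1) (leqnn _)).
  apply: (spec _ (i + b + (k - q.+1))).
    by apply/eq_factor => x hx; rewrite -!addnA !addnA -addnA IH ?addnA //; lia.
  by rewrite -!addnA !subnK // !addnA.
(* From [i + a] on the word has period [b - a], so every factor of length [i + b + 1] starts at one
   of the first [i + b] positions; there should be [i + b + 2] of them. *)
have [t [st ut mt et]] := hw (i + b).+1 isT.
have sub : {subset t <= [seq factor w x (i + b).+1 | x <- iota 0 (i + b)]}.
  move=> v /et[x <-]; elim/ltn_ind: x => x IH.
  case: (ltnP x (i + b)) => hx; first by apply: map_f; rewrite mem_iota.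
  have -> : factor w x (i + b).+1 = factor w (x - (b - a)) (i + b).+1.
    apply/eq_factor => k _.
    have := per (x - (i + b) + k).
    have -> : i + a + (x - (i + b) + k) = x - (b - a) + k by lia.
    by have -> : i + b + (x - (i + b) + k) = x + k by lia.
  by apply: IH; lia.
have := uniq_leq_size ut sub; rewrite size_map size_iota st; lia.
Qed.

(** Strong induction on the length: a shortest violation has windows [1 l 1] and [0 l 0] with [l] a
    palindrome of length [q]. Only one of [1 l], [0 l] can have two right extensions, and
    [sturmian_no_run] excludes the other. *)
Lemma sturmian_balanced w (hw : sturmian w) n i j :
  wcount w i n <= (wcount w j n).+1.
Proof.
elim/ltn_ind: n i j => n IH i j; rewrite leqNgt; apply/negP => hun.
(* The total excess is at least 2, while by minimality the prefix and the complementary suffix each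
   contribute at most 1. *)
have D k : 0 < k < n -> wcount w i k = (wcount w j k).+1.
  move=> hk.
  have h1 := IH k _ i j; have h2 := IH (n - k) _ (i + k) (j + k).
  have := wcountD w i k (n - k); have := wcountD w j k (n - k).
  rewrite subnKC; last lia.
  move=> e1 e2; have := h1 ltac:(lia); have := h2 ltac:(lia); lia.
have n2 : 2 <= n.
  by case: n hun {IH D} => [|[|//]]; rewrite ?wcountS !wcount0 ?addn0; case: (w _); case: (w _).
have [q eq] : exists q, n = q.+2 by exists n.-2; lia.
rewrite {n}eq in IH hun D n2.
have b1 (x y : bool) : x + 0 = (y + 0).+1 -> x = true /\ y = false by case: x; case: y.
have [wi wj] : w i = true /\ w j = false.
  have := D 1; rewrite !wcountSl !wcount0 => /(_ isT); exact: b1.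
have [wiN wjN] : w (i + q.+1) = true /\ w (j + q.+1) = false.
  have := D q.+1 ltac:(lia); move: hun; rewrite !(wcountS _ _ q.+1).
  by case: (w _); case: (w _) => //=; lia.
have eij k : 1 <= k <= q -> w (i + k) = w (j + k).
  move=> hk; have := D k ltac:(lia); have := D k.+1 ltac:(lia).
  by rewrite !wcountS; case: (w _); case: (w _) => //=; lia.
have eqc k x : 1 <= x -> x + k <= q.+1 -> wcount w (i + x) k = wcount w (j + x) k.
  move=> hx hk; apply: eq_wcount => y hy; rewrite -!addnA; apply: eij; lia.
(* Apply balance in length [k.+1] to a prefix of one window and a suffix of the other, in both ways;
   the end letters 1 and 0 turn the two inequalities into equality of the counts in [l]. *)
have palc k : k <= q -> wcount w i.+1 k = wcount w (i + (q.+1 - k)) k.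
  move=> hk.
  have h1 := IH k.+1 ltac:(lia) i (j + (q.+1 - k)).
  have h2 := IH k.+1 ltac:(lia) (i + (q.+1 - k)) j.
  move: h1 h2; rewrite (wcountSl w i k) (wcountSl w j k) (wcountS _ (j + _)) (wcountS _ (i + _)) wi wj.
  have -> : j + (q.+1 - k) + k = j + q.+1 by lia.
  have -> : i + (q.+1 - k) + k = i + q.+1 by lia.
  rewrite wiN wjN -(eqc k (q.+1 - k)); try lia.
  by have := eqc k 1; rewrite !addn1 => <- //; lia.
have pal k : 1 <= k <= q -> w (i + k) = w (i + (q.+1 - k)).
  case: k => // k hk; have := palc k.+1 ltac:(lia).
  rewrite wcountS wcountSl (palc k); last lia.
  have -> : (i + (q.+1 - k.+1)).+1 = i + (q.+1 - k) by lia.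
  by rewrite addSnnS; case: (w _); case: (w _) => //=; lia.
have palj k : 1 <= k <= q -> w (j + k) = w (j + (q.+1 - k)).
  by move=> hk; rewrite -eij // -eij ?(pal k) //; lia.
(* If [1 l] can be followed by 0, it is the special factor and [0 l] is always followed by 0;
   otherwise [1 l] is always followed by 1. *)
case: (pselect (exists x, factor w x q.+1 = factor w i q.+1 /\ w (x + q.+1) = false)).
  move=> [x [ex wx]].
  apply: (@sturmian_no_run w hw false q j i) => //.
  - by move=> k hk; rewrite eij.
  - move=> y ey; apply/negbTE/negP => hy.
    have : factor w i q.+1 = factor w j q.+1.
      apply: (@special_unique w hw q.+1 i x j y) => //.
      + by rewrite wiN wx.
      + by rewrite wjN hy.
    by rewrite !factorSl wi wj.
move=> hx; apply: (@sturmian_no_run w hw true q i j) => // x ex.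
by apply/negP => /negP hn; apply: hx; exists x; split => //; apply/negbTE.
Qed.

(** * The word of generators along the chain of z's *)

Lemma bounded_discrepancy w : periodic w \/ sturmian w ->
  exists C, forall i j n, wcount w i n <= wcount w j n + C.
Proof.
case=> [[p [p0 hp]]|hw]; last first.
  by exists 1 => i j n; rewrite addn1; apply: sturmian_balanced.
have wk i k : w (i + k * p) = w i.
  by elim: k => [|k IH]; rewrite ?addn0 // mulSn addnCA addnC hp.
have red i n : wcount w i n = wcount w (i %% p) n.
  apply: eq_wcount => k _; rewrite {1}(divn_eq i p).
  by rewrite -addnA addnC wk.
(* Splitting the prefix of length [i + n] in two ways shows that a window starting at [i] differs in
   count from the prefix of the same length by at most [i < p]. *)
exists p.*2 => i j n; rewrite (red i) (red j).
have := ltn_pmod i p0; have := ltn_pmod j p0.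
move: (i %% p) (j %% p) => {}i {}j hj hi.
have := wcountD w 0 i n; have := wcountD w 0 n i.
have := wcountD w 0 j n; have := wcountD w 0 n j.
rewrite !add0n (addnC n i) (addnC n j).
have := wcount_le w 0 i; have := wcount_le w n i.
have := wcount_le w 0 j; have := wcount_le w n j.
lia.
Qed.

Lemma few_factors w : periodic w \/ sturmian w ->
  exists C, forall n, exists s : seq (seq bool),
    size s <= n + C /\ forall i, factor w i n \in s.
Proof.
case=> [[p [p0 hp]]|hw].
  have wk i k : w (i + k * p) = w i.
    by elim: k => [|k IH]; rewrite ?addn0 // mulSn addnCA addnC hp.
  exists p => n; exists [seq factor w i n | i <- iota 0 p].
  split; first by rewrite size_map size_iota leq_addl.
  move=> i; apply/mapP; exists (i %% p); first by rewrite mem_iota ltn_pmod.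
  apply/eq_factor => k _; rewrite {1}(divn_eq i p).
  by rewrite -addnA addnC wk.
exists 1 => -[|n]; first by exists [:: [::]]; split.
by have [s [ss _ ms _]] := hw n.+1 isT; exists s; rewrite ss addn1.
Qed.

Definition nextz (m : nat) (w : nat -> bool) (x : nat * nat) : nat * nat :=
  if x.2 == m + weight w x.1 then (x.1.+1, 1) else (x.1, x.2.+1).

Definition zat m w p := iter p (nextz m w) (1, 1).

Lemma zatS m w p : zat m w p.+1 = nextz m w (zat m w p).
Proof. by []. Qed.

(* The generator, [true] for b and [false] for a, that does not annihilate the p-th z-vector. *)
Definition letter m w p : bool := (zat m w p).2 == m + weight w (zat m w p).1.

Lemma zat_valid m w p : 0 < m -> validb m w (inr (zat m w p)).
Proof.
move=> m0; elim: p => [|p]; first by rewrite /=; lia.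
rewrite zatS /nextz; case: (zat m w p) => i j /=.
case/and3P=> h1 h2 h3; case: eqP => e /=; first by lia.
by rewrite h1 ltn_neqAle h3 andbT; apply/eqP.
Qed.

Lemma zat_mul m w p c : 0 < m ->
  rawmul m w (inr (zat m w p)) (inl c) =
  if letter m w p == c then Some (inr (zat m w p.+1)) else None.
Proof.
move=> m0; have := zat_valid w p m0.
rewrite /letter zatS /nextz.
case: (zat m w p) => i j /= /and3P[_ _ h].
by rewrite ltn_neqAle h andbT; case: c; case: (j == _).
Qed.

Lemma zat_surj m w i j : 0 < m -> validb m w (inr (i, j)) -> exists p, zat m w p = (i, j).
Proof.
move=> m0 /= /and3P[hi hj hjm].
have row k i' p : zat m w p = (i', 1) -> k.+1 <= m + weight w i' ->
    zat m w (p + k) = (i', k.+1).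
  elim: k => [|k IH] e h; first by rewrite addn0.
  rewrite addnS zatS IH // /nextz /=; last lia.
  by case: eqP => //; lia.
have [p hp] : exists p, zat m w p = (i, 1).
  elim: i hi {hjm} => [//|[_ _|i IH _]]; first by exists 0.
  have [p hp] := IH isT; exists (p + (m + weight w i.+1).-1).+1.
  rewrite zatS (row _ i.+1) // /nextz /=; last lia.
  by rewrite prednK ?eqxx //; lia.
by exists (p + j.-1); rewrite (row _ i) // ?prednK.
Qed.

(** The first [i - 1] blocks have total length [m (i - 1) + w_1 + ... + w_(i-1)]; this converts
    positions in the chain into letter counts of [w]. *)
Lemma zat_pos m w p : 0 < m ->
  p.+1 = m * (zat m w p).1.-1 + wcount w 0 (zat m w p).1.-1 + (zat m w p).2.
Proof.
move=> m0; elim: p => [|p IH]; first by rewrite /= muln0 wcount0.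
have := zat_valid w p m0.
rewrite zatS /nextz {1}IH; case: (zat m w p) => i j /=.
case/and3P=> h1 h2 h3; case: eqP => e /=; last by rewrite addnS.
case: i h1 h2 h3 e {IH} => // i _ _ _; rewrite /= /weight /= => ->.
rewrite wcountS add0n mulnS; lia.
Qed.

Lemma zat_block m w p n : (zat m w (p + n)).1 = (zat m w p).1 + wcount (letter m w) p n.
Proof.
elim: n => [|n IH]; first by rewrite addn0 wcount0 addn0.
rewrite addnS wcountS addnA -IH /letter zatS /nextz.
by case: eqP => _ /=; rewrite ?addn1 ?addn0.
Qed.

(** Each b closes a block, so a window with [B] letters b has the length of [B] consecutive blocks,
    up to the two incomplete blocks at its ends; these account for the error [m]. *)
Lemma letter_wcount m w p n : 0 < m -> exists i,
  let B := wcount (letter m w) p n in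
  n <= m * B + wcount w i B + m /\ m * B + wcount w i B <= n + m.
Proof.
move=> m0; exists (zat m w p).1.-1; rewrite /=.
have := zat_pos w (p + n) m0; have := zat_pos w p m0.
have := zat_valid w p m0; have := zat_valid w (p + n) m0.
rewrite zat_block; set B := wcount (letter m w) p n.
case: (zat m w p) (zat m w (p + n)) => i j [i' j'] /= /and3P[_ h1 h2] /and3P[h3 h4 h5].
have -> : (i + B).-1 = i.-1 + B by lia.
rewrite mulnDr wcountD add0n; rewrite /weight in h2 h5.
have hb (b : bool) : b <= 1 by case: b.
have := hb (w i.-1); have := hb (w i'.-1).
lia.
Qed.

(** A factor is determined by its starting place inside a block, at most [m.+1] choices, and by the
    next [n] letters of [w], since each step enters at most one new block. *)
Lemma letter_few_factors m w : 0 < m -> periodic w \/ sturmian w ->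
  exists C, forall n, exists s : seq (seq bool),
    size s <= m.+1 * (n + C) /\ forall p, factor (letter m w) p n \in s.
Proof.
move=> m0 /few_factors[C hC]; exists C => n.
have [s [ss ms]] := hC n.
pose g (v : seq bool) j k := iter k (nextz m (nth false v)) (1, j).
pose f v j := [seq (g v j k).2 == m + weight (nth false v) (g v j k).1 | k <- iota 0 n].
exists [seq f v j | v <- s, j <- iota 1 m.+1]; split.
  by rewrite size_allpairs size_iota mulnC leq_mul2l ss orbT.
move=> p; case e: (zat m w p) => [i j].
have /and3P[hi hj hjm] : validb m w (inr (i, j)) by rewrite -e zat_valid.
apply/allpairsPdep; exists (factor w i.-1 n), j; split => /=; first exact: ms.
  have hj' : j \in iota 1 m.+1.
    by rewrite mem_iota hj /=; move: hjm; rewrite /weight; case: (w _); lia.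
  exact: hj'.
(* [g] follows the chain with blocks renumbered from 1, whence the offset [i.-1]; the bound on its
   block number keeps the lookups inside the factor of length [n]. *)
have h k : k < n -> (zat m w (p + k)).1 = (g (factor w i.-1 n) j k).1 + i.-1 /\
    (zat m w (p + k)).2 = (g (factor w i.-1 n) j k).2 /\
    1 <= (g (factor w i.-1 n) j k).1 <= k.+1.
  elim: k => [|k IH] hk; first by rewrite addn0 e /=; lia.
  have [e1 [e2 hb]] := IH (ltnW hk); move: e1 e2 hb.
  rewrite /g iterS -/(g _ j k) addnS zatS /nextz.
  move=> -> -> hb.
  have -> : weight w ((g (factor w i.-1 n) j k).1 + i.-1) =
     weight (nth false (factor w i.-1 n)) (g (factor w i.-1 n) j k).1.
    rewrite /weight nth_factor; last lia.
    by congr (nat_of_bool (w _)); lia.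
  by case: eqP => _ /=; lia.
rewrite {1}/factor /f; apply/eq_in_map => k; rewrite mem_iota => /andP[_ hk].
have [e1 [e2 hb]] := h k hk; rewrite /letter e1 e2; congr (_ == _ + _).
rewrite /weight nth_factor; last lia.
by congr (nat_of_bool (w _)); lia.
Qed.

(** * Multilinear evaluation and dimensions modulo identities *)

Section Pairing.
Local Open Scope ring_scope.
Variable F : fieldType.

(** Linear extension of [h] to formal combinations, used both for vectors and for polynomials. *)
Definition pairing (T : Type) (h : T -> F) (u : seq (F * T)) : F :=
  \sum_(p <- u) p.1 * h p.2.

Lemma pairing_cat (T : Type) (h : T -> F) u v :
  pairing h (u ++ v) = pairing h u + pairing h v.
Proof. by rewrite /pairing big_cat. Qed.

Lemma pairing_flatten (T : Type) (h : T -> F) us :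
  pairing h (flatten us) = \sum_(u <- us) pairing h u.
Proof. by rewrite /pairing big_flatten. Qed.

Lemma pairing_scale (T : Type) (h : T -> F) c u :
  pairing h [seq (c * q.1, q.2) | q <- u] = c * pairing h u.
Proof. by rewrite /pairing big_map mulr_sumr; apply: eq_bigr => q _; rewrite mulrA. Qed.

Lemma pairing0 (T : Type) (u : seq (F * T)) : pairing (fun _ => 0) u = 0.
Proof. by rewrite /pairing big1 // => p _; rewrite mulr0. Qed.

Lemma coefvE (T : eqType) (u : elem F T) t : coefv u t = pairing (fun x => (x == t)%:R) u.
Proof.
rewrite /coefv /pairing big_mkcond; apply: eq_bigr => p _.
by case: eqP => _; rewrite ?mulr1 ?mulr0.
Qed.

Lemma pairing_support (T : eqType) (h : T -> F) (u : elem F T) :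
  (forall x, coefv u x != 0 -> h x = 0) -> pairing h u = 0.
Proof.
move=> hu; pose X := undup [seq p.2 | p <- u].
have -> : pairing h u = \sum_(x <- X) coefv u x * h x.
  under [RHS]eq_bigr do rewrite /coefv mulr_suml.
  rewrite (exchange_big_dep predT) //= /pairing.
  apply: eq_big_seq => p pu.
  have pX : p.2 \in X by rewrite mem_undup map_f.
  rewrite -big_filter (bigD1_seq p.2) ?filter_uniq ?undup_uniq //=.
    rewrite big1_seq ?addr0 // => x /andP[hx]; rewrite mem_filter => /andP[/eqP e _].
    by rewrite e eqxx in hx.
  by rewrite mem_filter eqxx.
rewrite big1_seq // => x _; case: (eqVneq (coefv u x) 0) => [->|/hu ->].
  by rewrite mul0r.
by rewrite mulr0.
Qed.

Lemma pairing_lincomb (h : mono -> F) lam ps :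
  pairing h (lincomb lam ps) = \sum_(i < size ps) lam i * pairing h (nth [::] ps i).
Proof.
rewrite /lincomb pairing_flatten big_map -[size ps]subn0 -/(index_iota 0 _) big_mkord subn0.
by apply: eq_bigr => i _; rewrite pairing_scale.
Qed.

Section Evaluation.
Variables (T : eqType) (mt : T -> T -> option T).

Definition ohom (h : T -> F) (o : option T) : F := if o is Some r then h r else 0.

Lemma pairing_mulv h (u v : elem F T) :
  pairing h (mulv mt u v) = pairing (fun x => pairing (fun y => ohom h (mt x y)) v) u.
Proof.
rewrite /mulv pairing_flatten big_map; apply: eq_bigr => p _.
rewrite pairing_flatten big_map mulr_sumr; apply: eq_bigr => q _.
rewrite /mul_term /pairing; case: (mt _ _) => [r|] /=.
  by rewrite big_seq1 mulrA.
by rewrite big_nil !mulr0.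
Qed.

Definition upd (s : nat -> elem F T) i u : nat -> elem F T :=
  fun j => if j == i then u else s j.

Lemma eq_evalm (s s' : nat -> elem F T) t :
  {in leaves t, s =1 s'} -> evalm mt s t = evalm mt s' t.
Proof.
elim: t => [i|l IHl r IHr] /= h; first by rewrite h ?mem_head.
by rewrite IHl ?IHr // => i hi; apply: h; rewrite mem_cat hi ?orbT.
Qed.

Lemma evalm_linear (s : nat -> elem F T) i u t : count_mem i (leaves t) = 1%N -> forall h,
  pairing h (evalm mt (upd s i u) t) =
  pairing (fun x => pairing h (evalm mt (upd s i [:: (1, x)]) t)) u.
Proof.
elim: t => [j|l IHl r IHr] /=.
  rewrite addn0 /upd => + h; case: eqP => // _ _.
  by apply: eq_bigr => p _; rewrite /pairing big_seq1 mul1r.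
rewrite count_cat => hc h.
have notin t v : count_mem i (leaves t) = 0%N ->
    evalm mt (upd s i v) t = evalm mt s t.
  move=> h0; apply: eq_evalm => j hj; rewrite /upd; case: eqP => // e.
  by move/count_memPn: h0; rewrite -e hj.
have [[hl hr]|[hl hr]] : (count_mem i (leaves l) = 1%N /\ count_mem i (leaves r) = 0%N) \/
   (count_mem i (leaves l) = 0%N /\ count_mem i (leaves r) = 1%N).
  by move: hc; case: (count _ (leaves l)) => [|[|a]]; case: (count _ (leaves r)) => [|[|b]] //;
    [right|left].
- rewrite (notin _ _ hr) pairing_mulv IHl //.
  by apply: eq_bigr => p _; rewrite (notin _ _ hr) pairing_mulv.
- rewrite (notin _ _ hl) pairing_mulv [LHS]/pairing.
  under eq_bigr do rewrite IHr // /pairing mulr_sumr.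
  rewrite exchange_big; apply: eq_bigr => p _ /=.
  rewrite (notin _ _ hl) pairing_mulv /pairing mulr_sumr.
  by apply: eq_bigr => q _; rewrite !mulrA [q.1 * _]mulrC.
Qed.

Lemma pairing_evalp h (s : nat -> elem F T) (p : Defs.poly F) :
  pairing h (evalp mt s p) = pairing (fun t => pairing h (evalm mt s t)) p.
Proof.
rewrite /evalp pairing_flatten big_map; apply: eq_bigr => ct _.
by rewrite pairing_scale.
Qed.

Fixpoint evB (tau : nat -> T) (t : mono) : option T :=
  match t with
  | MV i => Some (tau i)
  | MM l r => obind (fun x => obind (mt x) (evB tau r)) (evB tau l)
  end.

Lemma evalm_basis tau t :
  evalm mt (fun i => [:: (1 : F, tau i)]) t =
  if evB tau t is Some r then [:: (1, r)] else [::].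
Proof.
elim: t => [//|l IHl r IHr] /=; rewrite IHl IHr.
case: (evB tau l) => [x|] //=; case: (evB tau r) => [y|] //=.
by rewrite /mulv /= /mul_term /= mulr1 !cats0.
Qed.

End Evaluation.
End Pairing.

(** * Bounds for the dimension modulo identities by linear functionals *)

Section Dimension.
Local Open Scope ring_scope.
Variables (F : fieldType) (T : eqType) (mt : T -> T -> option T).
Variables (n : nat) (Q : (nat -> elem F T) -> Prop).

Lemma in_Pn_lincomb lam (ps : seq (Defs.poly F)) :
  all (in_Pn n) ps -> in_Pn n (lincomb lam ps).
Proof.
move=> h; rewrite /in_Pn /lincomb.
have : all (fun i => i < size ps)%N (iota 0 (size ps)).
  by apply/allP => i; rewrite mem_iota => /andP[].
elim: (iota _ _) => //= i s IH /andP[hi /IH hs]; rewrite all_cat hs andbT all_map.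
exact: (all_nthP [::] h).
Qed.

(** With more polynomials than functionals, the matrix of values has a nonzero left kernel vector;
    the corresponding combination is an identity. *)
Lemma indep_mod_size (J : eqType) (js : seq J) (phi : J -> mono -> F) ps :
  (forall p, in_Pn n p -> (forall j, j \in js -> pairing (phi j) p = 0) -> is_id mt Q p) ->
  indep_mod mt n Q ps -> (size ps <= size js)%N.
Proof.
move=> hF [hps hind]; rewrite leqNgt; apply/negP => hlt.
pose A : 'M[F]_(size ps, size js) :=
  \matrix_(i, j) pairing (phi (tnth (in_tuple js) j)) (nth [::] ps i).
have /rowV0Pn[v /sub_kermxP hv v0] : kermx A != 0.
  rewrite -mxrank_eq0 mxrank_ker -lt0n subn_gt0.
  by apply: leq_ltn_trans hlt; apply: rank_leq_col.
pose lam i := if insub i is Some k then v 0 k else 0.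
have lamE (i : 'I_(size ps)) : lam i = v 0 i by rewrite /lam valK.
have hz : is_id mt Q (lincomb lam ps).
  apply: hF; first exact: in_Pn_lincomb.
  move=> _ /(tnthP (in_tuple js))[j ->]; rewrite pairing_lincomb.
  have := congr1 (fun M : 'rV_(size js) => M 0 j) hv.
  rewrite !mxE => h; rewrite -[RHS]h.
  by apply: eq_bigr => i _; rewrite lamE !mxE.
have h := hind _ hz.
move/eqP: v0; apply; apply/rowP => i; rewrite mxE -lamE; exact: h.
Qed.

Lemma dim_mod_exists N :
  (forall ps, indep_mod mt n Q ps -> (size ps <= N)%N) -> exists d, dim_mod mt n Q d.
Proof.
move=> hN; pose P d := `[< exists ps, size ps = d /\ indep_mod mt n Q ps >].
have exP : exists d, P d.
  exists 0%N; apply/asboolP; exists [::]; split => //; split => // lam _ i; by rewrite ltn0.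
have ubP d : P d -> (d <= N)%N by move=> /asboolP[ps [<- /hN]].
case: (ex_maxnP exP ubP) => d /asboolP hd hmax; exists d; split=> // ps hps.
by apply: hmax; apply/asboolP; exists ps.
Qed.

(** The values are prescribed only for [rk c' <= rk c], so the matrix is unitriangular when ordered
    by [rk]. The coefficients of a combination that is an identity are then killed by induction on
    [rk]. *)
Lemma dim_mod_lower (I : finType) (X : {set I}) (g : I -> Defs.poly F) (phi : I -> mono -> F)
    (rk : I -> nat) d :
  (forall c, c \in X -> in_Pn n (g c)) ->
  (forall p c, in_Pn n p -> c \in X -> is_id mt Q p -> pairing (phi c) p = 0) ->
  (forall c c', c \in X -> c' \in X -> (rk c' <= rk c)%N ->
     pairing (phi c') (g c) = (c' == c)%:R) ->
  dim_mod mt n Q d -> (#|X| <= d)%N.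
Proof.
move=> hg hphi tri [_ hmax].
have -> : #|X| = size [seq g c | c <- enum X] by rewrite size_map cardE.
have hall : all (in_Pn n) [seq g c | c <- enum X].
  by rewrite all_map; apply/allP => c; rewrite mem_enum => /hg.
apply: hmax; split => // lam hid.
rewrite size_map; set s := enum X in hall hid *.
have us : uniq s by apply: enum_uniq.
have sX c : c \in s -> c \in X by rewrite mem_enum.
pose l c := lam (index c s).
have sys c' : c' \in s -> \sum_(c <- s) l c * pairing (phi c') (g c) = 0.
  move=> hc'; rewrite -[RHS](hphi _ _ (in_Pn_lincomb lam hall) (sX _ hc') hid).
  rewrite pairing_lincomb size_map (big_nth c') big_mkord.
  by apply: eq_bigr => i _; rewrite (nth_map c') // /l index_uniq.
have l0 k : forall c', c' \in s -> (rk c' <= k)%N -> l c' = 0.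
  elim/ltn_ind: k => k IH c' hc' hk.
  have := sys c' hc'; rewrite (bigD1_seq c') //= tri ?sX ?eqxx ?mulr1 //.
  rewrite big1_seq ?addr0 // => c /andP[hcc hc].
  case: (leqP (rk c') (rk c)) => hr.
    by rewrite tri ?sX // eq_sym (negbTE hcc) mulr0.
  by rewrite (IH (rk c)) ?mul0r //; apply: leq_trans hk.
move=> i hi.
case e : s hi => [//|c0 s'] hi; rewrite -e in hi.
have hc := mem_nth c0 hi.
by have := l0 _ _ hc (leqnn _); rewrite /l index_uniq.
Qed.

End Dimension.

(** * Evaluation on basis vectors *)

(* A basis vector of the unital algebra: [None] is the unit, [Some (inl c)] a generator (c = true for b), and
   [Some (inr p)] the p-th vector of the chain of z's; the letter read at p is [U p]. *)
Definition sym : Type := option (bool + nat).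

Definition mulS (U : nat -> bool) (x y : sym) : option sym :=
  match x, y with
  | None, _ => Some y
  | _, None => Some x
  | Some (inr p), Some (inl c) => if U p == c then Some (Some (inr p.+1)) else None
  | _, _ => None
  end.

Fixpoint evS (U : nat -> bool) (sg : nat -> sym) (t : mono) : option sym :=
  match t with
  | MV i => Some (sg i)
  | MM l r => obind (fun x => obind (mulS U x) (evS U sg r)) (evS U sg l)
  end.

Definition isZ (x : sym) : bool := if x is Some (inr _) then true else false.
Definition zidx (x : sym) : nat := if x is Some (inr p) then p else 0.
Definition isN (x : sym) : bool := x != None.
Definition isB (x : sym) : bool := x == Some (inl true).

(* The numbers of z's, of non-units and of b's substituted for the variables of [s]; if there is exactly one z,
   [zs] is its index. *)
Definition nz (sg : nat -> sym) s := count (fun i => isZ (sg i)) s.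
Definition nn (sg : nat -> sym) s := count (fun i => isN (sg i)) s.
Definition nb (sg : nat -> sym) s := count (fun i => isB (sg i)) s.
Definition zs (sg : nat -> sym) s := sumn [seq zidx (sg i) | i <- s].

Lemma count_profile sg s : [/\ nz sg s + nb sg s <= nn sg s & nz sg s = 0 -> zs sg s = 0].
Proof.
rewrite /nz /nn /nb /zs; elim: s => //= i s [IH1 IH2].
by case: (sg i) => [[[]|q]|] /=; split; try lia; move=> h; rewrite IH2 //; lia.
Qed.

(** Among non-units only a z times the generator it expects is nonzero. Hence a nonzero product of
    at least two non-units contains exactly one z, every other non-unit moves it one step, and the
    b's used are those of the stretch of [U] traversed. *)
Lemma evS_profile U sg t r : evS U sg t = Some r ->
  let s := leaves t in
  match r with
  | None => nn sg s = 0
  | Some (inl c) => [/\ nz sg s = 0, nn sg s = 1 & nb sg s = c]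
  | Some (inr q) => [/\ nz sg s = 1, q.+1 = zs sg s + nn sg s
                     & nb sg s = wcount U (zs sg s) (nn sg s).-1]
  end.
Proof.
elim: t r => [i|l IHl r IHr] x /=.
  case=> <-; rewrite /nn /nz /nb /zs /=.
  by case: (sg i) => [[[]|q]|] //=; split; rewrite ?wcount0 //; lia.
have [hl1 hl2] := count_profile sg (leaves l).
have [hr1 hr2] := count_profile sg (leaves r).
case: (evS U sg l) IHl => [a|//] /(_ a erefl) /=.
case: (evS U sg r) IHr => [b|//] /(_ b erefl) /=.
move: hl1 hl2 hr1 hr2.
rewrite /nn /nz /nb /zs !count_cat map_cat sumn_cat.
move: (count _ (leaves l)) (count (fun _ => isN _) (leaves l)) (count (fun _ => isB _) (leaves l)).
move: (count _ (leaves r)) (count (fun _ => isN _) (leaves r)) (count (fun _ => isB _) (leaves r)).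
move: (sumn (map _ (leaves l))) (sumn (map _ (leaves r))) => P P' n1 n2 n3 n1' n2' n3'.
case: a => [[c|p]|]; case: b => [[c'|p']|] //=; last first.
- by move=> h1 h2 h3 h4 hb ha [<-]; lia.
- move=> h1 h2 h3 h4 [hb1 hb2 hb3] ha [<-].
  have [-> -> ->] : [/\ P = 0, n2' = 0 & n3' = 0] by split; [apply: h2; lia| lia | lia].
  by split=> //; lia.
- by move=> h1 h2 h3 h4 [hb1 hb2 hb3] ha [<-]; split; lia.
- move=> h1 h2 h3 h4 hb [ha1 ha2 ha3] [<-].
  have [-> -> ->] : [/\ P' = 0, n2 = 0 & n3 = 0] by split; [apply: h4; lia| lia | lia].
  by rewrite !addn0; split=> //; lia.
- move=> h1 h2 h3 h4 [hb1 hb2 hb3] [ha1 ha2 ha3].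
  case: eqP => // e [<-].
  have -> : P' = 0 by apply: h4; lia.
  rewrite addn0 hb2 addn1 /=; split; try lia.
  have -> : n2' = n2'.-1.+1 by lia.
  by rewrite wcountS ha3 hb3 -e; congr (_ + nat_of_bool (U _)); lia.
- by move=> h1 h2 h3 h4 hb [ha1 ha2 ha3] [<-]; split; lia.
Qed.

(** A nonzero value depends only on the counts in [evS_profile]. So under a fixed basis substitution
    a multilinear polynomial evaluates to a scalar times one basis vector. *)
Lemma evS_det U sg t t' r r' : perm_eq (leaves t) (leaves t') ->
  evS U sg t = Some r -> evS U sg t' = Some r' -> r = r'.
Proof.
move=> /seq.permP hp /evS_profile h /evS_profile h'; move: h h' => /=.
have hz : zs sg (leaves t) = zs sg (leaves t').
  by apply/perm_sumn/perm_map/seq.permP.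
have [+ _] := count_profile sg (leaves t').
rewrite /nz /nn /nb hz !hp.
move: (count _ _) (count (fun _ => isN _) _) (count (fun _ => isB _) _) => a b c hc.
case: r => [[x|x]|]; case: r' => [[y|y]|] //;
  try by [move=> [? ? ?] [? ? ?]; lia | move=> [? ? ?] ?; lia | move=> ? [? ? ?]; lia].
- by case=> _ _ -> [_ _ e]; congr (Some (inl _)); case: x y e => [] [].
- by case=> h1 h3 _ [h2 h4 _]; congr (Some (inr _)); lia.
Qed.

Definition shiftS p (x : sym) : sym := if x is Some (inr q) then Some (inr (p + q)) else x.

(** The starting index of the z can be normalised to 0 if [U] is replaced by the word read from
    there. Only as many letters as there are non-units besides the z matter, so a finite factor
    suffices. *)
Lemma evS_shift U V sg tau p t :
  (forall i, i \in leaves t -> sg i = shiftS p (tau i) /\ zidx (tau i) = 0) ->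
  (forall k, k.+1 < nn tau (leaves t) -> V k = U (p + k)) ->
  evS U sg t = omap (shiftS p) (evS V tau t).
Proof.
elim: t => [i|l IHl r IHr] /=; first by move=> /(_ i); rewrite mem_head => /(_ isT)[-> _].
rewrite /nn count_cat => hs hV.
rewrite IHl; first last.
- by move=> k hk; apply: hV; apply: leq_trans hk _; apply: leq_addr.
- by move=> i hi; apply: hs; rewrite mem_cat hi.
rewrite IHr; first last.
- by move=> k hk; apply: hV; apply: leq_trans hk _; apply: leq_addl.
- by move=> i hi; apply: hs; rewrite mem_cat hi orbT.
have hz0 s : {subset s <= leaves l ++ leaves r} -> zs tau s = 0.
  rewrite /zs; elim: s => //= i s IH h; rewrite (hs i _).2 ?h ?mem_head // IH //.
  by move=> j hj; apply: h; rewrite inE hj orbT.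
have := @evS_profile V tau l; case: (evS V tau l) => [x|] //= /(_ _ erefl) /=.
have := @evS_profile V tau r; case: (evS V tau r) => [y|] //= /(_ _ erefl) /=.
case: x => [[c|q]|]; case: y => [[c'|q']|] //=.
move=> [_ hr _] [_]; rewrite hz0; last by move=> i hi; rewrite mem_cat hi.
rewrite add0n => hl _.
rewrite hV; last by move: hl hr; rewrite /nn => <- ->; lia.
by case: eqP => _ //=; rewrite addnS.
Qed.

(** * Identities tested on admissible basis substitutions *)

Section Reduction.
Local Open Scope ring_scope.
Variables (F : fieldType) (T : eqType) (mt : T -> T -> option T).
Variables (n : nat) (Q : (nat -> elem F T) -> Prop).
Variables (U : nat -> bool) (h : sym -> T) (dom : pred sym) (al : nat -> pred sym).
Hypothesis dom_mul : forall x y r, dom x -> dom y -> mulS U x y = Some r -> dom r.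
Hypothesis h_mul : forall x y, dom x -> dom y -> mt (h x) (h y) = omap h (mulS U x y).
Hypothesis al_dom : forall i x, al i x -> dom x.
Hypothesis Q_supp : forall s, Q s -> forall i, (i < n)%N -> forall x, coefv (s i) x != 0 ->
  exists2 y, al i y & h y = x.
Hypothesis Q_sing : forall sg, (forall i, (i < n)%N -> al i (sg i)) ->
  Q (fun i => [:: (1, h (sg i))]).

(** By [evS_det] the sum of the coefficients of the surviving monomials is all that a substitution
    sees of a polynomial. *)
Definition alive (sg : nat -> sym) (t : mono) : F := (evS U sg t : bool)%:R.

Lemma evB_evS sg t : (forall i, i \in leaves t -> dom (sg i)) ->
  evB mt (h \o sg) t = omap h (evS U sg t) /\ (forall r, evS U sg t = Some r -> dom r).
Proof.
elim: t => [i|l IHl r IHr] /= hd.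
  by split => // r [<-]; apply: hd; rewrite mem_head.
have [|-> hl] := IHl; first by move=> i hi; apply: hd; rewrite mem_cat hi.
have [|-> hr] := IHr; first by move=> i hi; apply: hd; rewrite mem_cat hi orbT.
case: (evS U sg l) hl => [x|] //= /(_ x erefl) hx.
case: (evS U sg r) hr => [y|] //= /(_ y erefl) hy.
by split; [apply: h_mul | move=> z; apply: dom_mul].
Qed.

Lemma eq_pairing_Pn (f g : mono -> F) p : in_Pn n p ->
  (forall t, multilin n t -> f t = g t) -> pairing f p = pairing g p.
Proof.
move=> hp e; rewrite /pairing; elim: p hp => [_|[c t] p IH] /=; first by rewrite !big_nil.
by case/andP=> ht /IH; rewrite !big_cons /= => ->; rewrite e.
Qed.

Lemma multilin_lt t i : multilin n t -> i \in leaves t -> (i < n)%N.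
Proof. by move=> /perm_mem ->; rewrite mem_iota. Qed.

Lemma pairing_alive sg p : in_Pn n p -> (forall i, (i < n)%N -> al i (sg i)) ->
  (pairing (alive sg) p = 0 <->
   forall x, coefv (evalp mt (fun i => [:: (1, h (sg i))]) p) x = 0).
Proof.
move=> hp hsg.
have ev t : multilin n t -> evB mt (h \o sg) t = omap h (evS U sg t).
  by move=> ht; apply: (evB_evS _).1 => i /(multilin_lt ht) /hsg; apply: al_dom.
have coefE x : coefv (evalp mt (fun i => [:: (1, h (sg i))]) p) x =
    pairing (fun t => (omap h (evS U sg t) == Some x)%:R) p.
  rewrite coefvE pairing_evalp; apply: eq_pairing_Pn => // t /ev <-.
  rewrite evalm_basis /comp; case: (evB _ _ _) => [y|]; last by rewrite /pairing big_nil.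
  by rewrite /pairing big_seq1 mul1r.
have [[t0 [r0 [ht0 hr0]]]|none] :=
    pselect (exists t r, multilin n t /\ evS U sg t = Some r); last first.
  have dead t : multilin n t -> evS U sg t = None.
    by move=> ht; case e: (evS U sg t) => [r|] //; case: none; exists t, r.
  split=> [_ x|_].
    by rewrite coefE (@eq_pairing_Pn _ (fun=> 0)) ?pairing0 // => t /dead ->.
  by rewrite (@eq_pairing_Pn _ (fun=> 0)) ?pairing0 // /alive => t /dead ->.
have val t : multilin n t -> omap h (evS U sg t) = if evS U sg t then Some (h r0) else None.
  move=> ht; case e: (evS U sg t) => [r|] //=; congr (Some (h _)).
  by apply: evS_det e hr0; rewrite (perm_trans ht) // perm_sym.
have coefE' x : coefv (evalp mt (fun i => [:: (1, h (sg i))]) p) x =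
    (h r0 == x)%:R * pairing (alive sg) p.
  rewrite coefE (@eq_pairing_Pn _ (fun t => (h r0 == x)%:R * alive sg t)) //.
    by rewrite /pairing mulr_sumr; apply: eq_bigr => ct _; rewrite mulrCA.
  move=> t /val ->; rewrite /alive; case: (evS U sg t) => [_|] /=; last by rewrite mulr0.
  by rewrite mulr1.
split=> [e x|]; first by rewrite coefE' e mulr0.
by move=> /(_ (h r0)); rewrite coefE' eqxx mul1r.
Qed.

(** Multilinear expansion. The parameters cover all cases at once: [al i] holds the symbols allowed
    for variable [i], and [dom] excludes the unit when the algebra has none. *)
Lemma is_id_alive p : in_Pn n p ->
  (is_id mt Q p <->
   forall sg, (forall i, (i < n)%N -> al i (sg i)) -> pairing (alive sg) p = 0).
Proof.
move=> hp; split=> [hid sg hsg|hal].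
  by apply/(pairing_alive hp hsg) => x; apply: hid; apply: Q_sing.
move=> s /Q_supp hs x.
have eval_eq (s1 s2 : nat -> elem F T) : (forall i, (i < n)%N -> s1 i = s2 i) ->
    coefv (evalp mt s1 p) x = coefv (evalp mt s2 p) x.
  move=> e; rewrite !coefvE !pairing_evalp; apply: eq_pairing_Pn => // t ht.
  by congr pairing; apply: eq_evalm => i /(multilin_lt ht) /e.
(* Induction on the number [k] of variables not yet specialised to a single basis vector. *)
suff K k : (k <= n)%N -> forall s : nat -> elem F T,
    (forall i, (i < k)%N -> forall x, coefv (s i) x != 0 -> exists2 y, al i y & h y = x) ->
    (forall i, (k <= i < n)%N -> exists2 y, al i y & s i = [:: (1, h y)]) ->
    coefv (evalp mt s p) x = 0.
  apply: (K n (leqnn _) s) => // i; lia.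
elim: k => [_|k IH hk] {hs}s hs1 hs2.
  have /choice[sg hsg] : forall i, exists y, (i < n)%N -> al i y /\ s i = [:: (1, h y)].
    move=> i; case: (ltnP i n) => hi; last by exists None.
    by have [y hy e] := hs2 i hi; exists y.
  have hsg' i : (i < n)%N -> al i (sg i) by move=> /hsg[].
  rewrite (eval_eq s (fun i => [:: (1, h (sg i))])); last by move=> i /hsg[].
  exact: (pairing_alive hp hsg').1 (hal _ hsg') x.
have -> : coefv (evalp mt s p) x = coefv (evalp mt (upd s k (s k)) p) x.
  by apply: eval_eq => i _; rewrite /upd; case: eqP => [->|].
have lin u : coefv (evalp mt (upd s k u) p) x =
    pairing (fun y => coefv (evalp mt (upd s k [:: (1, y)]) p) x) u.
  rewrite coefvE pairing_evalp.
  under [RHS]eq_bigr do rewrite coefvE pairing_evalp /pairing mulr_sumr.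
  rewrite exchange_big /=.
  transitivity (pairing (fun t => pairing (fun y => pairing (fun z => (z == x)%:R)
      (evalm mt (upd s k [:: (1, y)]) t)) u) p).
    apply: eq_pairing_Pn => // t ht; apply: evalm_linear.
    by have /seq.permP -> := ht; rewrite count_uniq_mem ?iota_uniq // mem_iota hk.
  apply: eq_bigr => ct _; rewrite /pairing mulr_sumr; apply: eq_bigr => q _.
  by rewrite mulrCA.
rewrite lin; apply: pairing_support => y hy; apply: IH; first exact: ltnW.
  move=> i hi z; rewrite /upd; case: (eqVneq i k) => [e|_]; first by rewrite e ltnn in hi.
  by apply: hs1; apply: leq_trans hi _.
move=> i /andP[h1 h2]; rewrite /upd; case: (eqVneq i k) => [->|/eqP ne].
  by have [z hz <-] := hs1 k (leqnn _) y hy; exists z.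
by apply: hs2; lia.
Qed.

End Reduction.

(** * Upper bound by role configurations *)

(* Role of each variable in a basis substitution: the unit ([None]), a vector z ([Some None]), a generator
   ([Some (Some c)]). *)
Notation cfg n := {ffun 'I_n -> option (option bool)}.

Definition role (x : sym) : option (option bool) :=
  match x with None => None | Some (inl c) => Some (Some c) | Some (inr _) => Some None end.
Definition toS (x : option (option bool)) : sym :=
  match x with None => None | Some None => Some (inr 0) | Some (Some c) => Some (inl c) end.

Lemma toSK : cancel toS role.
Proof. by case=> [[c|]|]. Qed.

Section Configurations.
Variable n : nat.
Implicit Types (c : cfg n) (sg : nat -> sym).

Definition ext c (i : nat) : sym := if insub i is Some k then toS (c k) else None.
Definition roles sg : cfg n := [ffun i : 'I_n => role (sg i)].

Lemma extE c (i : 'I_n) : ext c i = toS (c i).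
Proof. by rewrite /ext valK. Qed.

Lemma ext_roles sg i : i < n -> ext (roles sg) i = toS (role (sg i)).
Proof. by move=> hi; rewrite -[i]/(val (Ordinal hi)) extE ffunE. Qed.

Lemma ext_inj c c' : (forall i, i < n -> ext c i = ext c' i) -> c = c'.
Proof.
move=> h; apply/ffunP => i; apply: (can_inj toSK).
by rewrite -!extE; apply: h.
Qed.

Lemma zidx_ext c i : zidx (ext c i) = 0.
Proof. by rewrite /ext; case: insub => // k; case: (c k) => [[]|]. Qed.

Definition cz c := nz (ext c) (iota 0 n).
Definition cn c := nn (ext c) (iota 0 n).
Definition cb c := nb (ext c) (iota 0 n).

Lemma count_roles sg :
  [/\ cz (roles sg) = nz sg (iota 0 n), cn (roles sg) = nn sg (iota 0 n)
    & cb (roles sg) = nb sg (iota 0 n)].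
Proof.
split; apply: eq_in_count => i; rewrite mem_iota => /andP[_ hi]; rewrite ext_roles //.
- by case: (sg i) => [[]|].
- by case: (sg i) => [[]|].
- by case: (sg i) => [[[]|]|].
Qed.

(* A necessary condition for some multilinear monomial not to vanish on [c]; the index 0 given to z by [toS] is
   replaced by an arbitrary position p of the chain. *)
Definition relevant (U : nat -> bool) c : bool :=
  (cz c == 0) && (cn c <= 1) ||
  (cz c == 1) && `[< exists p, cb c = wcount U p (cn c).-1 >].

Lemma zs_single sg s i q : nz sg s = 1 -> i \in s -> sg i = Some (inr q) -> zs sg s = q.
Proof.
elim: s => // j s IH; rewrite /nz /zs /= inE => h /orP[/eqP ij|hi] e.
  subst j; move: h; rewrite e /= add1n => -[h].
  by have [_ h0] := count_profile sg s; have := h0 h; rewrite /zs => ->; rewrite addn0.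
have := IH _ hi e; rewrite /zs.
have : 0 < count (fun i => isZ (sg i)) s.
  by rewrite -has_count; apply/hasP; exists i => //; rewrite e.
move: h; case: (sg j) => [[b|p]|] //= h h0 hs; first by apply: hs.
  by lia.
by apply: hs.
Qed.

(** A surviving substitution acts on monomials through its roles and one factor of [U], so finitely
    many functionals remain for each [n]. *)
Lemma evS_roles U sg t r : multilin n t -> evS U sg t = Some r ->
  relevant U (roles sg) /\
  forall t', multilin n t' ->
    (evS U sg t' : bool) =
    evS (nth false (factor U (zs sg (iota 0 n)) (cn (roles sg)).-1)) (ext (roles sg)) t'.
Proof.
move=> ht /evS_profile; have /seq.permP hp := ht.
have hz : zs sg (leaves t) = zs sg (iota 0 n) by apply/perm_sumn/perm_map.
rewrite /nz /nn /nb hz !hp -/(nz sg _) -/(nn sg _) -/(nb sg _) /=.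
have [e1 e2 e3] := count_roles sg; rewrite -e1 -e2 -e3 => hr.
have hz1 : cz (roles sg) <= 1.
  have [h _] := count_profile sg (iota 0 n); rewrite -e1 -e2 -e3 in h.
  by move: hr; case: r => [[x [? ? ?]|x [? ? ?]]|?]; lia.
split.
  rewrite /relevant; move: hr; case: r => [[x [-> -> _]|x [-> _ hb]]|h] //=.
    by apply/asboolP; exists (zs sg (iota 0 n)).
  have [] := count_profile sg (iota 0 n); rewrite -e1 -e2 -e3 h.
  by move=> h' _; apply/orP; left; lia.
move=> t' ht'; have /seq.permP hp' := ht'.
rewrite (@evS_shift U (nth false (factor U (zs sg (iota 0 n)) (cn (roles sg)).-1)) sg
   (ext (roles sg)) (zs sg (iota 0 n))).
- by case: (evS _ _ _).
- move=> i /(multilin_lt ht') hi; rewrite zidx_ext ext_roles //; split=> //.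
  case e: (sg i) => [[b|q]|] //=; rewrite addn0.
  congr (Some (inr _)); symmetry; apply: (zs_single (i := i)) => //; last by rewrite mem_iota.
  apply/eqP; rewrite eqn_leq -{1}e1 hz1 /= -has_count; apply/hasP; exists i.
    by rewrite mem_iota.
  by rewrite e.
- move=> k; rewrite /nn hp' -/(nn _ _) -/(cn _) => hk.
  by rewrite nth_factor //; lia.
Qed.

End Configurations.

Section UpperBound.
Local Open Scope ring_scope.
Variables (F : fieldType) (T : eqType) (mt : T -> T -> option T).
Variables (n : nat) (Q : (nat -> elem F T) -> Prop).
Variables (U : nat -> bool) (al : nat -> pred sym).
Hypothesis is_idP : forall p, in_Pn n p ->
  (is_id mt Q p <->
   forall sg, (forall i, (i < n)%N -> al i (sg i)) -> pairing (alive F U sg) p = 0).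

Lemma indep_mod_upper (X : {set cfg n}) (ls : nat -> seq (seq bool)) M ps :
  (forall p k, factor U p k \in ls k) -> (forall k, (k <= n)%N -> (size (ls k) <= M)%N) ->
  (forall sg, (forall i, (i < n)%N -> al i (sg i)) -> relevant U (roles n sg) ->
     roles n sg \in X) ->
  indep_mod mt n Q ps -> (size ps <= #|X| * M)%N.
Proof.
move=> hls hM hX.
pose js := [seq (c, v) | c <- enum X, v <- ls (cn c).-1].
have hjs : (size js <= #|X| * M)%N.
  rewrite size_allpairs_dep sumnE big_map cardE -sum1_size big_distrl /=.
  apply: leq_sum => c _; rewrite mul1n; apply: hM.
  by rewrite (leq_trans (leq_pred _)) // -[X in (_ <= X)%N](size_iota 0 n) count_size.
move=> hps; apply: leq_trans hjs.
apply: (indep_mod_size (phi := fun j => alive F (nth false j.2) (ext j.1))) hps => p hp hj.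
apply/(is_idP hp) => sg hsg.
have [[t0 [r0 [ht0 hr0]]]|none] :=
    pselect (exists t r, multilin n t /\ evS U sg t = Some r); last first.
  rewrite (@eq_pairing_Pn F n _ (fun=> 0)) ?pairing0 // => t ht.
  by rewrite /alive; case e: (evS U sg t) => [r|] //; case: none; exists t, r.
have [hrel hev] := evS_roles ht0 hr0.
rewrite -(hj (roles n sg, factor U (zs sg (iota 0 n)) (cn (roles n sg)).-1)).
  by apply: (eq_pairing_Pn hp) => t /hev e; rewrite /alive /= e.
by apply/allpairsPdep; exists (roles n sg), (factor U (zs sg (iota 0 n)) (cn (roles n sg)).-1);
  split=> //; rewrite mem_enum; apply: hX.
Qed.

End UpperBound.

(** * Left-normed monomials and iterated associators *)

Definition lnorm (t : mono) (xs : seq nat) : mono := foldl (fun t x => MM t (MV x)) t xs.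

Lemma leaves_lnorm t xs : leaves (lnorm t xs) = leaves t ++ xs.
Proof.
by elim: xs t => [|x xs IH] t /=; rewrite ?cats0 // IH /= -catA.
Qed.

Lemma evS_lnorm_None U sg t xs : evS U sg t = None -> evS U sg (lnorm t xs) = None.
Proof. by elim: xs t => //= x xs IH t h; apply: IH; rewrite /= h. Qed.

Lemma evS_lnorm U sg t q xs : evS U sg t = Some (Some (inr q)) ->
  all (fun x => isN (sg x)) xs ->
  (evS U sg (lnorm t xs) : bool) =
  ([seq sg x | x <- xs] == [seq Some (inl (U (q + k))) | k <- iota 0 (size xs)]).
Proof.
elim: xs t q => [|x xs IH] t q /= e; first by rewrite e.
case/andP=> hx hxs; rewrite addn0.
have -> : [seq Some (inl (U (q + k))) | k <- iota 1 (size xs)] =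
    [seq Some (@inl bool nat (U (q.+1 + k))) | k <- iota 0 (size xs)].
  by rewrite (iotaDl 1 0) -map_comp; apply: eq_map => k /=; rewrite addnA addn1.
case ex : (sg x) hx => [[c|p]|] // _; last by rewrite evS_lnorm_None //= e ex.
rewrite eqseq_cons; case: (eqVneq (U q) c) => [hc|hc].
  by rewrite hc eqxx /=; apply: IH; rewrite //= e ex /= hc eqxx.
rewrite evS_lnorm_None; last by rewrite /= e ex /= (negbTE hc).
by apply/esym/negbTE/negP => /andP[/eqP[e'] _]; case/eqP: hc.
Qed.

Lemma evS_lnorm_unit U sg t xs : all (fun x => ~~ isN (sg x)) xs ->
  evS U sg (lnorm t xs) = evS U sg t.
Proof.
elim: xs t => //= x xs IH t /andP[hx hxs]; rewrite IH //=.
case: (evS U sg t) => //= y; move: hx; rewrite /isN negbK => /eqP->.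
by case: y => [[c|p]|].
Qed.

Section Chains.
Local Open Scope ring_scope.
Variables (F : fieldType) (U : nat -> bool) (sg : nat -> sym).
Implicit Types (q : Defs.poly F) (h : option sym -> F).

Definition massoc q x y : Defs.poly F :=
  [seq (ct.1, MM (MM ct.2 (MV x)) (MV y)) | ct <- q] ++
  [seq (- ct.1, MM ct.2 (MM (MV x) (MV y))) | ct <- q].

(* Iterated associators [((q, x1, x2), x3, x4), ...]: an associator vanishes as soon as one of its entries is the
   unit, while modulo the identity [u (v w) = 0] of the non-unital algebra it is the left-normed product. *)
Fixpoint achain q xs : Defs.poly F :=
  if xs is x :: y :: xs' then achain (massoc q x y) xs' else q.

Definition wrap q xs : Defs.poly F := [seq (ct.1, lnorm ct.2 xs) | ct <- q].

(** Leaving [h] arbitrary lets every outer multiplication be absorbed into [h], so that the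
    vanishing of an inner associator passes to the whole chain. *)
Definition value h q : F := pairing (fun t => h (evS U sg t)) q.

Definition mulO (o o' : option sym) : option sym :=
  obind (fun x => obind (mulS U x) o') o.

Lemma value_massoc h q x y :
  value h (massoc q x y) =
  value (fun o => h (mulO (mulO o (Some (sg x))) (Some (sg y)))) q -
  value (fun o => h (mulO o (mulO (Some (sg x)) (Some (sg y))))) q.
Proof.
rewrite /value /massoc pairing_cat; congr (_ + _); first by rewrite /pairing big_map.
by rewrite /pairing big_map -sumrN; apply: eq_bigr => ct _; rewrite mulNr.
Qed.

Lemma mulO_unitl o : mulO (Some None) o = o.
Proof. by case: o. Qed.

Lemma mulO_unitr o : mulO o (Some None) = o.
Proof. by case: o => [[[c|p]|]|]. Qed.

Lemma massoc_unit h q x y : sg x = None \/ sg y = None -> value h (massoc q x y) = 0.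
Proof.
move=> hxy; rewrite value_massoc; apply/eqP; rewrite subr_eq0; apply/eqP.
by apply: eq_bigr => ct _; case: hxy => ->; rewrite ?mulO_unitl !mulO_unitr.
Qed.

Lemma massoc_unit0 h i x y : sg i = None -> value h (massoc [:: (1, MV i)] x y) = 0.
Proof.
move=> hi; rewrite value_massoc /value /pairing !big_seq1.
have -> : evS U sg (1 : F, MV i).2 = Some None by rewrite /= hi.
by rewrite !mulO_unitl subrr.
Qed.

Lemma achain_zero q xs : (forall h, value h q = 0) -> forall h, value h (achain q xs) = 0.
Proof.
elim/ltn_ind: {xs}(size xs) {-2}xs (erefl (size xs)) q => k IH [|x [|y xs]] //= hk q hq h.
by apply: (IH (size xs)) => // [|h']; [lia | rewrite value_massoc !hq subrr].
Qed.

Lemma achain_unit q xs : ~~ odd (size xs) -> has (fun x => ~~ isN (sg x)) xs ->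
  forall h, value h (achain q xs) = 0.
Proof.
elim/ltn_ind: {xs}(size xs) {-2}xs (erefl (size xs)) q => k IH [|x [|y xs]] //= hk q ho.
rewrite !negbK orbA => /orP[hx|hx]; last by apply: (IH (size xs)) => //; [lia | lia].
apply: achain_zero => h; apply: massoc_unit.
by move: hx => /orP[] /eqP; [left|right].
Qed.

Definition nonunit q := all (fun ct => evS U sg ct.2 != Some None) q.

Lemma mulO_nonunit o o' : o != Some None -> o' != Some None -> mulO o o' != Some None.
Proof.
case: o => [[[c|p]|]|] //; case: o' => [[[c'|p']|]|] //= _ _.
by case: ifP.
Qed.

(** A nonzero product of two non-units is a z, and multiplying a non-unit by a z on the right gives
    zero. *)
Lemma mulO3_nonunit o o' o'' : o != Some None -> o' != Some None -> o'' != Some None ->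
  mulO o (mulO o' o'') = None.
Proof.
case: o => [[[c|p]|]|] //; case: o' => [[[c'|p']|]|] //; case: o'' => [[[c''|p'']|]|] //= _ _ _;
  by case: ifP.
Qed.

Lemma wrap_cat q q' xs : wrap (q ++ q') xs = wrap q xs ++ wrap q' xs.
Proof. by rewrite /wrap map_cat. Qed.

Lemma achain_nonunit q xs h : h None = 0 -> ~~ odd (size xs) ->
  all (fun x => isN (sg x)) xs -> nonunit q -> value h (achain q xs) = value h (wrap q xs).
Proof.
move=> h0.
elim/ltn_ind: {xs}(size xs) {-2}xs (erefl (size xs)) q => k IH [|x [|y xs]] //= hk q.
  by move=> _ _ _; rewrite /wrap /value /pairing big_map.
rewrite negbK => ho /and3P[hx hy hxs] hq.
have hxN : Some (sg x) != Some None :> option sym by [].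
have hyN : Some (sg y) != Some None :> option sym by [].
have nq1 : nonunit [seq (ct.1, MM (MM ct.2 (MV x)) (MV y)) | ct <- q].
  rewrite /nonunit all_map; apply: sub_all hq => ct hct /=.
  exact: mulO_nonunit (mulO_nonunit hct hxN) hyN.
have nq2 : all (fun ct => evS U sg ct.2 == None)
    [seq (- ct.1, MM ct.2 (MM (MV x) (MV y))) | ct <- q].
  rewrite all_map; apply: sub_all hq => ct hct /=; apply/eqP.
  exact: mulO3_nonunit hct hxN hyN.
rewrite (IH (size xs)) //; [|lia|]; last first.
  by rewrite /nonunit all_cat; apply/andP; split=> //; apply: sub_all nq2 => ct /eqP->.
rewrite wrap_cat /value pairing_cat -!/(value _ _).
have -> : value h (wrap [seq (- ct.1, MM ct.2 (MM (MV x) (MV y))) | ct <- q] xs) = 0.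
  move: nq2; rewrite /value /pairing /wrap; elim: [seq _ | _ <- q] => [|ct s IHs] /=.
    by rewrite big_nil.
  case/andP=> /eqP e hs; rewrite big_cons /= IHs // addr0.
  by rewrite evS_lnorm_None // h0 mulr0.
by rewrite addr0 /wrap -map_comp.
Qed.

End Chains.

(** * Lower bound by triangular test polynomials *)

Lemma perm_map_lift (T : eqType) (f : nat -> T) s t :
  perm_eq (map f s) t -> exists2 s', perm_eq s' s & map f s' = t.
Proof.
case: s => [|x s].
  by rewrite perm_sym => /perm_nilP->; exists [::].
rewrite perm_sym => /(perm_iotaP (f x))[Is hI ->].
rewrite size_map in hI.
exists [seq nth x (x :: s) i | i <- Is].
  by rewrite (perm_trans (perm_map _ hI)) // map_nth_iota0 // take_size.
rewrite -map_comp; apply/eq_in_map => i hi.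
by rewrite (nth_map x) //; move: hi; rewrite (perm_mem hI) mem_iota.
Qed.

Lemma perm_eq_bool (s t : seq bool) : size s = size t -> count id s = count id t -> perm_eq s t.
Proof.
move=> hsz hc; apply/allP => -[] _ /=.
  have e u : count_mem true u = count id u by apply: eq_count; case.
  by rewrite !e hc.
have e u : count_mem false u = size u - count id u.
  have <- := count_predC id u; rewrite addKn; apply: eq_count; by case.
by rewrite !e hc hsz.
Qed.

Lemma wcount_count U n : wcount U 0 n = count id (map U (iota 0 n)).
Proof.
elim: n => [|n IH]; first by rewrite wcount0.
by rewrite wcountS IH -[in RHS]addn1 iotaD map_cat count_cat /= addn0.
Qed.

Section Orderings.
Variable n : nat.
Implicit Types c : cfg n.

Definition csupp c := [seq i <- iota 0 n | isN (ext c i)].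
Definition cunit c := [seq i <- iota 0 n | ~~ isN (ext c i)].

Lemma size_csupp c : size (csupp c) = cn c.
Proof. by rewrite size_filter. Qed.

Lemma ext_isZ c i : isZ (ext c i) -> ext c i = Some (inr 0).
Proof. by have := zidx_ext c i; case: (ext c i) => [[|p /= ->]|]. Qed.

(* The variables outside the unit role, arranged so that the left-normed product read along them is nonzero. *)
Definition arrangement (U : nat -> bool) c (o : nat * seq nat) : Prop :=
  [/\ perm_eq (o.1 :: o.2) (csupp c), ext c o.1 = Some (inr 0)
    & [seq ext c x | x <- o.2] = [seq Some (inl (U k)) | k <- iota 0 (size o.2)]].

(** The generator roles contain as many b's as the prefix of [U] of the same length, so the
    variables can be ordered to spell that prefix. *)
Lemma arrangement_exists U c : cz c = 1 -> cb c = wcount U 0 (cn c).-1 ->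
  exists o, arrangement U c o.
Proof.
move=> hz hb; pose z := [seq i <- csupp c | isZ (ext c i)].
pose l := [seq i <- csupp c | ~~ isZ (ext c i)].
have hzl : perm_eq (z ++ l) (csupp c) by rewrite perm_filterC.
have sz : size z = 1.
  rewrite -hz /cz /nz size_filter /csupp count_filter; apply: eq_count => i /=.
  by case: (ext c i) => [[]|].
have [i0 ez] : exists i0, z = [:: i0].
  by case e: z sz => [|i0 [|]] // _; exists i0.
have hi0 : ext c i0 = Some (inr 0).
  have : i0 \in z by rewrite ez mem_head.
  by rewrite mem_filter => /andP[/ext_isZ].
have sl : size l = (cn c).-1.
  by have := perm_size hzl; rewrite size_cat size_csupp sz => <-.
have [xs hxs exs] : exists2 xs, perm_eq xs l &
    map (fun i => isB (ext c i)) xs = map U (iota 0 (size l)).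
  apply/perm_map_lift/perm_eq_bool; first by rewrite !size_map size_iota.
  rewrite -wcount_count sl -hb count_map /cb /nb /l /csupp !count_filter.
  apply: eq_count => i /=; rewrite /isB /isN; by case: (ext c i) => [[[]|]|].
exists (i0, xs); split=> //=.
  by rewrite -cat1s -ez (perm_trans _ hzl) // perm_cat2l.
have -> : [seq Some (inl (U k)) | k <- iota 0 (size xs)] =
    [seq Some (@inl bool nat b) | b <- map U (iota 0 (size l))].
  by rewrite -map_comp (perm_size hxs).
rewrite -exs -map_comp; apply/eq_in_map => i /=.
rewrite (perm_mem hxs) !mem_filter /isB => /andP[h1 /andP[h2 _]].
by move: h1 h2; case: (ext c i) => [[[]|]|].
Qed.

(** To survive, [c'] must put the z on the first variable and spell [U] along the others, which
    forces its roles to be those of [c]. *)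
Lemma evS_arrangement U c c' o : arrangement U c o -> cz c' = 1 -> csupp c' = csupp c ->
  (evS U (ext c') (lnorm (MV o.1) o.2) : bool) = (c' == c).
Proof.
case: o => i0 xs [/= hp hi0 hx] hz' hs.
have suppP i : (i \in i0 :: xs) = (i < n) && isN (ext c i).
  by rewrite (perm_mem hp) mem_filter mem_iota andbC.
have suppP' i : (i \in i0 :: xs) = (i < n) && isN (ext c' i).
  by rewrite (perm_mem hp) -hs mem_filter mem_iota andbC.
have isn : all (fun x => isN (ext c' x)) xs.
  by apply/allP => x hxx; have := suppP' x; rewrite inE hxx orbT => /esym/andP[].
case: (boolP (isZ (ext c' i0))) => [/ext_isZ hi0'|hnz]; last first.
  have -> : (c' == c) = false.
    by apply/negbTE; apply: contra hnz => /eqP->; rewrite hi0.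
  (* With the first variable a generator, either it is the only non-unit, contradicting [cz c' = 1],
     or its product with the next non-unit is already zero. *)
  case: xs hp hx suppP suppP' isn => [|x xs] hp hx suppP suppP' isn.
    move: hz'; rewrite /cz /nz.
    have -> : count (fun i => isZ (ext c' i)) (iota 0 n) = count (fun i => isZ (ext c' i)) (csupp c').
      rewrite /csupp count_filter; apply: eq_count => i /=; by case: (ext c' i) => [[]|].
    by rewrite hs -(seq.permP hp) /= (negbTE hnz).
  rewrite /= evS_lnorm_None //=.
  have := suppP' i0; rewrite mem_head => /esym/andP[_].
  move: isn => /= /andP[+ _].
  by case: (ext c' i0) hnz => [[b|]|] //; case: (ext c' x) => [[|]|].
rewrite (@evS_lnorm U _ _ 0) //=; last by rewrite hi0'.
have -> : [seq Some (inl (U (0 + k))) | k <- iota 0 (size xs)] = [seq ext c x | x <- xs] by [].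
apply/eqP/eqP => [/eq_in_map e|->//]; apply: ext_inj => i hi.
case: (boolP (i \in i0 :: xs)) => [|hni].
  by rewrite inE => /orP[/eqP->|/e//]; rewrite hi0 hi0'.
have := suppP i; have := suppP' i; rewrite (negbTE hni) hi /= /isN => /esym/negbFE/eqP->.
by move=> /esym/negbFE/eqP->.
Qed.

End Orderings.

Section LowerBound.
Local Open Scope ring_scope.
Variables (F : fieldType) (T : eqType) (mt : T -> T -> option T).
Variables (n : nat) (Q : (nat -> elem F T) -> Prop).
Variables (U : nat -> bool) (al : nat -> pred sym).
Hypothesis is_idP : forall p, in_Pn n p ->
  (is_id mt Q p <->
   forall sg, (forall i, (i < n)%N -> al i (sg i)) -> pairing (alive F U sg) p = 0).
Variable X : {set cfg n}.
Hypothesis X_al : forall c, c \in X -> forall i, (i < n)%N -> al i (ext c i).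
Hypothesis X_cz : forall c, c \in X -> cz c = 1%N.
Hypothesis X_cb : forall c, c \in X -> cb c = wcount U 0 (cn c).-1.

Let X_arr : exists o : cfg n -> nat * seq nat, forall c, c \in X -> arrangement U c (o c).
Proof.
suff /choice[o ho] : forall c, exists o, c \in X -> arrangement U c o by exists o.
move=> c; case: (boolP (c \in X)) => [hc|_]; last by exists (0%N, [::]).
by have [o ho] := arrangement_exists (X_cz hc) (X_cb hc); exists o.
Qed.

Let pairing_id (p : Defs.poly F) c : in_Pn n p -> c \in X -> is_id mt Q p -> pairing (alive F U (ext c)) p = 0.
Proof. by move=> hp hc /(is_idP hp); apply; apply: X_al. Qed.

Lemma dim_lower_full d : (forall c, c \in X -> cn c = n) -> dim_mod mt n Q d -> (#|X| <= d)%N.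
Proof.
move=> hn; have [o ho] := X_arr.
have full c : c \in X -> csupp c = iota 0 n.
  by move=> hc; apply/all_filterP; rewrite all_count size_iota; apply/eqP; apply: hn.
pose g c : Defs.poly F := [:: (1, lnorm (MV (o c).1) (o c).2)].
apply: (dim_mod_lower (g := g) (phi := fun c => alive F U (ext c)) (rk := fun=> 0%N)) => //.
  move=> c hc; have [hp _ _] := ho c hc.
  by rewrite /in_Pn /= andbT /multilin leaves_lnorm -(full c hc).
move=> c c' hc hc' _; rewrite /pairing big_seq1 mul1r /alive.
by rewrite (evS_arrangement (ho c hc)) ?X_cz // !full.
Qed.

Lemma achain_leaves q s xs : ~~ odd (size xs) ->
  all (fun ct => leaves ct.2 == s) q ->
  all (fun ct => leaves ct.2 == s ++ xs) (@achain F q xs).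
Proof.
elim/ltn_ind: {xs}(size xs) {-2}xs (erefl (size xs)) q s => k IH [|x [|y xs]] //= hk q s.
  by rewrite cats0.
rewrite negbK => hx hq.
rewrite -(cat1s y) -(cat1s x) !catA.
apply: (IH (size xs)); [by rewrite -hk; apply: leqnSn | by [] | by [] |].
rewrite all_cat !all_map; apply/andP; split; apply: sub_all hq => ct /= /eqP->.
  by [].
by rewrite -catA.
Qed.

Lemma value_wrap sg (h : option sym -> F) es : exists h', forall q, value U sg h (wrap q es) = value U sg h' q.
Proof.
elim: es h => [|e es IH] h.
  by exists h => q; rewrite /value /wrap /pairing big_map.
have [h' hh] := IH h; exists (fun o => h' (mulO U o (Some (sg e)))) => q.
have -> : wrap q (e :: es) = wrap [seq (ct.1, MM ct.2 (MV e)) | ct <- q] es.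
  by rewrite /wrap -map_comp.
by rewrite hh /value /pairing big_map.
Qed.

(** The test polynomial of [c] vanishes on [c'] unless all non-units of [c] are non-units of [c'].
    If also [cn c' <= cn c], the two supports agree and the associators reduce to a left-normed
    monomial; hence the triangularity by [cn]. *)
Lemma dim_lower_unital d : (forall c, c \in X -> odd (cn c) && (1 < cn c)%N) ->
  dim_mod mt n Q d -> (#|X| <= d)%N.
Proof.
move=> hodd; have [o ho] := X_arr.
have szo c : c \in X -> (size (o c).2).+1 = cn c.
  by move=> /ho[/perm_size /= -> _ _]; rewrite size_csupp.
have evo c : c \in X -> ~~ odd (size (o c).2).
  by move=> hc; have /andP[] := hodd c hc; rewrite -szo.
pose g c : Defs.poly F := wrap (achain [:: (1, MV (o c).1)] (o c).2) (cunit c).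
apply: (dim_mod_lower (g := g) (phi := fun c => alive F U (ext c)) (rk := @cn n)) => //.
  move=> c hc; have [hp _ _] := ho c hc.
  rewrite /in_Pn /g /wrap all_map.
  have := @achain_leaves [:: (1, MV (o c).1)] [:: (o c).1] (o c).2 (evo c hc).
  rewrite /= eqxx => /(_ isT); apply: sub_all => ct /= /eqP e.
  rewrite /multilin leaves_lnorm e /= -cat_cons.
  rewrite (perm_trans (_ : perm_eq _ (csupp c ++ cunit c))) ?perm_cat2r //.
  by rewrite perm_filterC.
move=> c c' hc hc' hrk.
pose h (o : option sym) : F := (o : bool)%:R.
change (value U (ext c') h (g c) = (c' == c)%:R).
have [hp hi0 _] := ho c hc.
have suppo i : (i \in (o c).1 :: (o c).2) = (i \in csupp c) by rewrite (perm_mem hp).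
case: (boolP (has (fun i => ~~ isN (ext c' i)) ((o c).1 :: (o c).2))) => hu.
  have -> : (c' == c) = false.
    apply/negbTE/eqP => e; move: hu; rewrite e => /hasP[i].
    by rewrite suppo mem_filter => /andP[->].
  have [h' hh] := value_wrap (ext c') h (cunit c); rewrite hh.
  case: (boolP (has (fun i => ~~ isN (ext c' i)) (o c).2)) => hu2.
    by apply: achain_unit => //; apply: evo.
  move: hu; rewrite /= (negbTE hu2) orbF /isN negbK => /eqP hi.
  (* The variable of the z has become a unit. As [1 < cn c], there is at least one associator, and
     that variable is its first entry. *)
  have := szo c hc; have := evo c hc; have /andP[_] := hodd c hc.
  case: (o c).2 => [|x [|y xs]] //; first by move=> h1 _ h2; rewrite -h2 in h1.
  by move=> _ _ _ /=; apply: achain_zero => h''; apply: massoc_unit0.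
have isn i : i \in (o c).1 :: (o c).2 -> isN (ext c' i).
  by move=> hi; apply: contraR hu => hN; apply/hasP; exists i.
have sub : {subset csupp c <= csupp c'}.
  move=> i hi; rewrite mem_filter isn ?suppo //.
  by move: hi; rewrite mem_filter => /andP[].
have uc : uniq (csupp c) by rewrite filter_uniq ?iota_uniq.
have [|_ eqs] := uniq_min_size uc sub; first by rewrite !size_csupp.
have es : csupp c' = csupp c.
  apply: eq_in_filter => i hi; have := eqs i; rewrite !mem_filter hi !andbT => ->.
  by [].
rewrite /g.
have -> : value U (ext c') h (wrap (achain [:: (1, MV (o c).1)] (o c).2) (cunit c)) =
    value U (ext c') h (achain [:: (1, MV (o c).1)] (o c).2).
  rewrite /value /wrap /pairing big_map; apply: eq_bigr => ct _ /=.
  rewrite evS_lnorm_unit //; apply/allP => i; rewrite mem_filter => /andP[hN hi].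
  by apply: contra hN => hN'; have := eqs i; rewrite !mem_filter hi hN' !andbT.
rewrite achain_nonunit ?evo //.
- rewrite /wrap /value /pairing /= big_seq1 mul1r /h.
  by rewrite (evS_arrangement (ho c hc)) ?X_cz.
- by apply/allP => i hi; apply: isn; rewrite inE hi orbT.
- rewrite /nonunit /= andbT; have := isn (o c).1 (mem_head _ _).
  by rewrite /isN.
Qed.

End LowerBound.

(** * Counting configurations *)

Section Counting.
Variable n : nat.
Implicit Types c : cfg n.

Lemma count_ext (A : pred sym) c :
  count (fun i => A (ext c i)) (iota 0 n) = \sum_(i < n) A (toS (c i)).
Proof.
rewrite -sum1_count big_mkcond -[n in iota 0 n]subn0 -/(index_iota 0 n) big_mkord.
by apply: eq_bigr => i _; rewrite extE; case: (A _).
Qed.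

Definition permc (s : 'S_n) c : cfg n := [ffun i => c (s i)].

Lemma count_permc (A : pred sym) s c :
  count (fun i => A (ext (permc s c) i)) (iota 0 n) = count (fun i => A (ext c i)) (iota 0 n).
Proof.
rewrite !count_ext [RHS](reindex_inj (@perm_inj _ s)).
by apply: eq_bigr => i _; rewrite ffunE.
Qed.

Lemma permc_inj s : injective (permc s).
Proof.
move=> c c' /ffunP h; apply/ffunP => i.
by have := h (s^-1 i)%g; rewrite !ffunE permKV.
Qed.

Lemma permcKV s c : permc s (permc s^-1 c)%g = c.
Proof. by apply/ffunP => i; rewrite !ffunE permK. Qed.

Variable dl : bool -> bool.

Definition degc (e : bool) (x : option (option bool)) : bool :=
  match x with None => false | Some None => e | Some (Some c) => dl c end.

Definition evens e c : {set 'I_n} := [set i | ~~ degc e (c i)].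

Lemma evens_permc e s c i : (i \in evens e (permc s c)) = (s i \in evens e c).
Proof. by rewrite !inE ffunE. Qed.

Lemma count_mem_set (E : {set 'I_n}) : count id [tuple i \in E | i < n] = #|E|.
Proof.
by rewrite /= -sum1_count big_map big_enum_cond /= sum1_card.
Qed.

Lemma perm_of_sets (E E' : {set 'I_n}) : #|E| = #|E'| ->
  exists s : 'S_n, forall i, (i \in E) = (s i \in E').
Proof.
move=> h.
have /tuple_permP[s hs] : perm_eq [tuple i \in E | i < n] [tuple i \in E' | i < n].
  by apply: perm_eq_bool; rewrite ?size_tuple // !count_mem_set.
exists s => i.
have := congr1 (fun t : seq bool => nth false t i) hs.
by rewrite -!tnth_nth !tnth_mktuple.
Qed.

Variable P : {set cfg n}.
Hypothesis P_perm : forall s c, c \in P -> permc s c \in P.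

(** A permutation carrying [E] to [E'] acts on [P], so only the size of the set of even variables
    matters. *)
Lemma card_evens e (E E' : {set 'I_n}) : #|E| = #|E'| ->
  #|[set c in P | evens e c == E]| = #|[set c in P | evens e c == E']|.
Proof.
move=> /perm_of_sets[s hs].
rewrite -[RHS](card_imset _ (@permc_inj s)).
apply: eq_card => c; apply/idP/imsetP => [|[c' hc' ->]].
  rewrite inE => /andP[hc /eqP hE].
  exists (permc s^-1%g c); last by rewrite permcKV.
  rewrite inE P_perm //=; apply/eqP/setP => i.
  by rewrite evens_permc hE hs permKV.
move: hc'; rewrite !inE => /andP[hc /eqP hE]; rewrite P_perm //=.
by apply/eqP/setP => i; rewrite evens_permc hE hs.
Qed.

(* The parity pattern of the variables is read off the configuration, hence every configuration is counted once. *)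
Lemma sum_graded_configurations e :
  \sum_(k < n.+1) 'C(n, k) * #|[set c in P | [forall i : 'I_n, degc e (c i) == (k <= i)]]| = #|P|.
Proof.
pose E0 (k : nat) : {set 'I_n} := [set i : 'I_n | i < k].
have cE0 k : k <= n -> #|E0 k| = k.
  move=> hk; have inj : injective (widen_ord hk) by move=> i j /(congr1 val) /= /val_inj.
  rewrite -[RHS]card_ord -(card_imset _ inj).
  apply: eq_card => i; rewrite inE; apply/idP/imsetP => [hi|[j _ ->]] //=.
  by exists (Ordinal hi) => //; apply: val_inj.
have e0 (k : nat) : [set c in P | [forall i : 'I_n, degc e (c i) == (k <= i)]] =
    [set c in P | evens e c == E0 k].
  apply/setP => c; rewrite !inE; congr (_ && _); apply/forallP/eqP => [h|h i].
    by apply/setP => i; rewrite !inE (eqP (h i)) -ltnNge.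
  by have /setP/(_ i) := h; rewrite !inE ltnNge => /negb_inj->.
transitivity (\sum_(k < n.+1) \sum_(E : {set 'I_n} | #|E| == k) #|[set c in P | evens e c == E]|).
  apply: eq_bigr => k _; rewrite e0.
  rewrite (eq_bigr (fun=> #|[set c in P | evens e c == E0 k]|)); last first.
    move=> E /eqP hE; apply: card_evens; rewrite cE0 //.
    by rewrite -ltnS.
  rewrite sum_nat_const; congr (_ * _).
  by have := card_draws 'I_n k; rewrite card_ord => <-; apply: eq_card => E; rewrite inE.
rewrite (exchange_big_dep predT) //=.
rewrite (eq_bigr (fun E => #|[set c in P | evens e c == E]|)); last first.
  move=> E _; have hE : #|E| < n.+1 by rewrite ltnS -[leqRHS](card_ord n) max_card.
  rewrite (big_pred1 (Ordinal hE)) // => k; by rewrite eq_sym.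
rewrite -[RHS]sum1_card (partition_big (evens e) predT) //=.
by apply: eq_bigr => E _; rewrite -sum1_card; apply: eq_bigl => c; rewrite inE.
Qed.

End Counting.

(** * Weighted upper counts and binomial lower counts of configurations *)

Section Weights.
Local Open Scope ring_scope.
Variables (K : realFieldType) (wt : option (option bool) -> K).
Hypothesis wt_ge0 : forall x, 0 <= wt x.

(** The product weights of all configurations add up to the right-hand side, and each member of [X]
    contributes at least [kappa]. *)
Lemma card_weight n (X : {set cfg n}) (kappa : K) :
  (forall c, c \in X -> kappa <= \prod_i wt (c i)) ->
  #|X|%:R * kappa <= (\sum_x wt x) ^+ n.
Proof.
move=> h.
have -> : (\sum_x wt x) ^+ n = \sum_(c : cfg n) \prod_i wt (c i).
  by rewrite -(bigA_distr_bigA (fun _ => wt)) prodr_const card_ord.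
rewrite (bigID (mem X)) /= -[leLHS]addr0; apply: lerD; last first.
  by apply: sumr_ge0 => c _; apply: prodr_ge0.
rewrite mulr_natl -sumr_const; exact: ler_sum.
Qed.

Definition nu (sg : nat -> sym) s := count (fun i => ~~ isN (sg i)) s.
Definition na (sg : nat -> sym) s := count (fun i => sg i == Some (inl false)) s.

Lemma count_parts sg s :
  (nu sg s + nn sg s)%N = size s /\ (na sg s + nb sg s + nz sg s)%N = nn sg s.
Proof.
rewrite /nu /nn /na /nb /nz; elim: s => //= i s [IH1 IH2].
by case: (sg i) => [[[]|]|] /=; lia.
Qed.

Lemma prod_weight n (c : cfg n) :
  \prod_i wt (c i) =
  wt None ^+ nu (ext c) (iota 0 n) * wt (Some None) ^+ cz c *
  wt (Some (Some false)) ^+ na (ext c) (iota 0 n) * wt (Some (Some true)) ^+ cb c.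
Proof.
transitivity (\prod_(i <- iota 0 n) wt (role (ext c i))).
  rewrite -[n in iota 0 n]subn0 -/(index_iota 0 n) big_mkord.
  by apply: eq_bigr => i _; rewrite extE toSK.
rewrite /cz /cb /nu /na /nb /nz; elim: (iota 0 n) => [|i s IH].
  by rewrite big_nil /= !expr0 !mulr1.
rewrite big_cons IH /=; case: (ext c i) => [[[]|q]|] /=; rewrite ?add0n ?add1n ?exprS.
- by rewrite mulrCA.
- by rewrite mulrA [X in X * _]mulrCA.
- by rewrite !mulrA [_ * wt None ^+ _]mulrC.
- by rewrite !mulrA.
Qed.

End Weights.

Section PairCount.
Variables (n : nat) (B : nat -> nat) (P : pred nat).

(** The z is fixed on the first variable, which costs only a factor linear in [n]. For [T] inside
    [S], the set [S] carries the generators and [T] the b's. *)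
Definition cfg_of_sets (S T : {set 'I_n}) : cfg n.+1 :=
  [ffun i => if unlift ord0 i is Some j then
               if j \in T then Some (Some true) else if j \in S then Some (Some false) else None
             else Some None].

Lemma cfg_of_sets_counts (S T : {set 'I_n}) : T \subset S ->
  [/\ cz (cfg_of_sets S T) = 1, cn (cfg_of_sets S T) = #|S|.+1 & cb (cfg_of_sets S T) = #|T|].
Proof.
move=> /subsetP hTS.
have card (A : {set 'I_n}) : #|A| = \sum_(i < n) (i \in A).
  by rewrite -sum1_card big_mkcond; apply: eq_bigr => i _; case: (i \in A).
rewrite /cz /cn /cb /nz /nn /nb !count_ext !big_ord_recl !ffunE unlift_none /= !card.
split.
- rewrite big1 // => i _; rewrite ffunE liftK.
  by case: (i \in T); case: (i \in S).
- rewrite add1n; congr _.+1; apply: eq_bigr => i _; rewrite ffunE liftK.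
  by case: (boolP (i \in T)) => [/hTS->|_] //; case: (i \in S).
- rewrite add0n; apply: eq_bigr => i _; rewrite ffunE liftK.
  by case: (i \in T) => //; case: (i \in S).
Qed.

Lemma card_pairs_lower (X : {set cfg n.+1}) :
  (forall c, cz c = 1 -> P (cn c).-1 -> cb c = B (cn c).-1 -> c \in X) ->
  \sum_(s < n.+1 | P s) 'C(n, s) * 'C(s, B s) <= #|X|.
Proof.
move=> hX.
pose Y := [set st : {set 'I_n} * {set 'I_n} |
            [&& P #|st.1|, st.2 \subset st.1 & #|st.2| == B #|st.1|]].
have inj : {in Y &, injective (fun st => cfg_of_sets st.1 st.2)}.
  move=> [S T] [S' T']; rewrite !inE /= => /and3P[_ /subsetP h1 _] /and3P[_ /subsetP h2 _] /ffunP e.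
  have e' i : (i \in T) = (i \in T') /\ (i \in S) = (i \in S').
    have := e (lift ord0 i); rewrite !ffunE liftK.
    have := h1 i; have := h2 i.
    by case: (i \in T); case: (i \in S); case: (i \in T'); case: (i \in S') => // a b;
      try (by have := a isT); try (by have := b isT).
  by congr (_, _); apply/setP => i; have [] := e' i.
have <- : #|Y| = \sum_(s < n.+1 | P s) 'C(n, s) * 'C(s, B s).
  transitivity (\sum_(st : {set 'I_n} * {set 'I_n} |
      P #|st.1| && ((st.2 \subset st.1) && (#|st.2| == B #|st.1|))) 1).
    by rewrite -sum1_card; apply: eq_bigl => st; rewrite inE.
  rewrite -(pair_big_dep (fun S : {set 'I_n} => P #|S|)
             (fun S T : {set 'I_n} => (T \subset S) && (#|T| == B #|S|)) (fun _ _ => 1)) /=.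
  rewrite (eq_bigr (fun S : {set 'I_n} => 'C(#|S|, B #|S|))); last first.
    move=> S _; rewrite -cards_draws sum1_card; apply: eq_card => T.
    by rewrite inE.
  have cS (S : {set 'I_n}) : #|S| < n.+1 by rewrite ltnS -[leqRHS](card_ord n) max_card.
  rewrite (partition_big (fun S : {set 'I_n} => Ordinal (cS S)) (fun s : 'I_n.+1 => P s)) //=.
  apply: eq_bigr => s hs.
  rewrite (eq_bigr (fun=> 'C(s, B s))); last by move=> S /andP[_ /eqP <-].
  rewrite sum_nat_const; congr (_ * _).
  have := card_draws 'I_n s; rewrite card_ord => <-.
  apply: eq_card => S; rewrite !inE unfold_in /=.
  by rewrite -val_eqE /=; case: eqP => [->|]; rewrite ?hs ?andbF.
rewrite -(card_in_imset inj); apply: subset_leq_card; apply/subsetP => _ /imsetP[[S T] hST ->].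
move: hST; rewrite inE /= => /and3P[hP hTS /eqP hT].
by have [e1 e2 e3] := cfg_of_sets_counts hTS; apply: hX; rewrite ?e2 ?e3.
Qed.

End PairCount.

(* The term [j = t] is the largest in the binomial expansion of [(t + (N - t)) ^ N]. *)
Lemma bin_mode N t : t <= N -> N ^ N <= N.+1 * ('C(N, t) * t ^ t * (N - t) ^ (N - t)).
Proof.
move=> ht; pose f j := 'C(N, j) * t ^ j * (N - t) ^ (N - j).
have ratio j : j < N -> f j.+1 * (j.+1 * (N - t)) = f j * ((N - j) * t).
  move=> hj; rewrite /f expnS.
  have -> : (N - t) ^ (N - j) = (N - t) * (N - t) ^ (N - j.+1) by rewrite -expnS; congr (_ ^ _); lia.
  have h := mul_bin_left N j.
  transitivity (t * t ^ j * ((N - t) ^ (N - j.+1)) * (N - t) * (j.+1 * 'C(N, j.+1))); first by lia.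
  by rewrite h; lia.
have up j : t <= j -> j < N -> f j.+1 <= f j.
  move=> h1 h2; have hX : 0 < j.+1 * (N - t) by rewrite muln_gt0 /=; lia.
  rewrite -(leq_pmul2r hX) ratio // leq_mul2l; apply/orP; right.
  by rewrite mulnC; apply: leq_mul; lia.
have dn j : j < t -> f j <= f j.+1.
  move=> h1; have hX : 0 < (N - j) * t by rewrite muln_gt0; apply/andP; split; lia.
  rewrite -(leq_pmul2r hX) -ratio; last by lia.
  rewrite leq_mul2l; apply/orP; right; rewrite [leqRHS]mulnC.
  by apply: leq_mul; lia.
have fmax j : j <= N -> f j <= f t.
  move=> hj; case: (leqP t j) => htj.
    elim: j htj hj => [|j IH]; first by rewrite leqn0 => /eqP->.
    rewrite leq_eqVlt => /orP[/eqP->//|htj] hj.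
    by apply: leq_trans (up j _ _) (IH _ _); lia.
  have [d ed] : exists d, t = j + d by exists (t - j); lia.
  have : forall d, j + d <= t -> f j <= f (j + d).
    elim=> [|d' IH] hd; first by rewrite addn0.
    by rewrite addnS; apply: leq_trans (IH _) (dn _ _); lia.
  by move=> /(_ d); rewrite -ed; apply.
rewrite -/(f t) -{1}(subnK ht) expnDn.
apply: leq_trans (_ : \sum_(i < N.+1) f t <= _); last by rewrite sum_nat_const card_ord.
apply: leq_sum => i _; apply: leq_trans (fmax i _); last by rewrite -ltnS.
by rewrite /f -mulnA [X in _ * X]mulnC.
Qed.

(** * Real analysis *)

Section Analysis.
Local Open Scope R_scope.

Lemma INR_addn (a b : nat) : INR (a + b)%N = INR a + INR b.
Proof. exact: plus_INR. Qed.

Lemma INR_muln (a b : nat) : INR (a * b)%N = INR a * INR b.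
Proof. exact: mult_INR. Qed.

Lemma INR_subn (a b : nat) : (b <= a)%N -> INR (a - b)%N = INR a - INR b.
Proof. by move=> h; rewrite -[in RHS](subnK h) INR_addn; lra. Qed.

Lemma INR_expn (a b : nat) : INR (a ^ b)%N = pow (INR a) b.
Proof. by elim: b => [|b IH] //=; rewrite expnS INR_muln IH. Qed.

Lemma INR_leq (a b : nat) : (a <= b)%N -> INR a <= INR b.
Proof. by move=> h; rewrite -(subnK h) INR_addn; have := pos_INR (b - a)%N; lra. Qed.

Lemma exp_mulnat a n : exp (a * INR n) = pow (exp a) n.
Proof.
elim: n => [|n IH]; first by rewrite Rmult_0_r exp_0.
by rewrite S_INR Rmult_plus_distr_l exp_plus IH Rmult_1_r /= Rmult_comm.
Qed.

Lemma pow_exp_ln x n : 0 < x -> pow x n = exp (INR n * ln x).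
Proof. by move=> h; rewrite Rmult_comm exp_mulnat exp_ln. Qed.

Lemma exp_le x y : x <= y -> exp x <= exp y.
Proof. by case=> [/exp_increasing|->]; lra. Qed.

Lemma Phi_pos x : 0 < Phi x.
Proof. by apply: Rinv_0_lt_compat; apply: Rmult_lt_0_compat; apply: exp_pos. Qed.

Lemma ln_Phi x : ln (Phi x) = - (x * ln x + (1 - x) * ln (1 - x)).
Proof. by rewrite /Phi /Rpower -exp_plus -exp_Ropp ln_exp. Qed.

Lemma Phi_gt1 x : 0 < x < 1 -> 1 < Phi x.
Proof.
move=> hx; rewrite -exp_0 -[Phi x]exp_ln; last exact: Phi_pos.
apply: exp_increasing; rewrite ln_Phi.
have h1 : ln x < 0 by rewrite -ln_1; apply: ln_increasing; lra.
have h2 : ln (1 - x) < 0 by rewrite -ln_1; apply: ln_increasing; lra.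
by nra.
Qed.

(** The product is 1 at [t = x N], by the definition of [Phi]; a deviation of [t] costs only an
    exponential linear in it. *)
Lemma Phi_term x N t : 0 < x < 1 -> (t <= N)%N ->
  pow (Phi x) N * pow x t * pow (1 - x) (N - t)%N =
  exp ((INR t - x * INR N) * (ln x - ln (1 - x))).
Proof.
move=> hx ht; rewrite !pow_exp_ln; try lra; last exact: Phi_pos.
by rewrite -!exp_plus INR_subn // ln_Phi; congr exp; ring.
Qed.


Lemma exp_add1 a n : 0 < a -> INR n + 1 <= (1 + / a) * exp (a * INR n).
Proof.
move=> ha; have h0 := pos_INR n; have := exp_ineq1_le (a * INR n).
have h1 : 1 <= exp (a * INR n) by rewrite -exp_0; apply: exp_le; nra.
move=> h2; have hi := Rinv_0_lt_compat _ ha.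
have : / a * (a * INR n) <= / a * exp (a * INR n) by apply: Rmult_le_compat_l; lra.
by rewrite -Rmult_assoc Rinv_l; lra.
Qed.

Lemma polynomial_subexp (C : R) a : 0 <= C -> 0 < a ->
  exists2 K, 0 < K & forall n, C * (INR n + 1) <= K * exp (a * INR n).
Proof.
move=> hC ha; have hi := Rinv_0_lt_compat _ ha.
exists ((C + 1) * (1 + / a)); first by nra.
move=> n; have := @exp_add1 a n ha; have := exp_pos (a * INR n); have := pos_INR n.
move=> h1 h2 h3; apply: Rle_trans (_ : (C + 1) * ((1 + / a) * exp (a * INR n)) <= _); last by lra.
by apply: Rmult_le_compat; lra.
Qed.

(** [K] is chosen before [p], so the frequency is uniform over all starting positions. *)
Definition uniform_freq (U : nat -> bool) (x : R) : Prop :=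
  forall eps, 0 < eps -> exists2 K, 0 <= K &
    forall p N, Rabs (INR (wcount U p N) - x * INR N) <= eps * INR N + K.

Lemma slope_wcount w n :
  sum_f_R0 (fun i => if w i then 1 else 0) n = INR (wcount w 0 n.+1).
Proof.
elim: n => [|n IH] /=.
  by rewrite wcountS wcount0 add0n; case: (w 0%N).
by rewrite IH [in RHS]wcountS INR_addn add0n; case: (w n.+1) => /=; lra.
Qed.

Lemma slope_bounds w alpha : slope w alpha -> 0 <= alpha <= 1.
Proof.
move=> h; have b n : 0 <= sum_f_R0 (fun i => if w i then 1 else 0) n / INR n.+1 <= 1.
  rewrite slope_wcount; have hn := lt_0_INR n.+1 ltac:(lia).
  have h1 := pos_INR (wcount w 0 n.+1); have h2 := INR_leq (wcount_le w 0 n.+1).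
  have hi := Rinv_0_lt_compat _ hn; split; first by apply: Rmult_le_pos; lra.
  by rewrite -(Rinv_r (INR n.+1)); [apply: Rmult_le_compat_r; lra | lra].
split; apply: Rnot_lt_le => ha.
  have [N hN] := h (- alpha) ltac:(lra); have := hN N (le_n _); have := b N.
  by rewrite /Rdist => ? /Rabs_def2; lra.
have [N hN] := h (alpha - 1) ltac:(lra); have := hN N (le_n _); have := b N.
by rewrite /Rdist => ? /Rabs_def2; lra.
Qed.

Lemma slope_discrepancy w alpha : slope w alpha -> forall eps, 0 < eps ->
  exists2 K, 0 <= K & forall n, Rabs (INR (wcount w 0 n) - alpha * INR n) <= eps * INR n + K.
Proof.
move=> h eps he; have ha := slope_bounds h; have [N hN] := h eps he.
exists (INR N); first exact: pos_INR.
move=> n; have h0 := pos_INR n.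
have h1 := pos_INR (wcount w 0 n); have h2 := INR_leq (wcount_le w 0 n).
case: (leqP n N) => hn.
  by have := INR_leq hn => h3; apply: Rabs_le; nra.
case: n hn h0 h1 h2 => // n hn h0 h1 h2.
have := hN n ltac:(lia); rewrite slope_wcount /Rdist => h3.
have hp := lt_0_INR n.+1 ltac:(lia).
have -> : INR (wcount w 0 n.+1) - alpha * INR n.+1 =
    (INR (wcount w 0 n.+1) / INR n.+1 - alpha) * INR n.+1 by field; lra.
by rewrite Rabs_mult (Rabs_pos_eq (INR n.+1)) //; have := pos_INR N; nra.
Qed.

(** A window of length [N] with [B] letters b satisfies [N = (m + alpha) B] up to a small linear
    error, uniformly by bounded discrepancy; dividing by [m + alpha] gives the frequency. *)
Lemma letter_freq m w alpha : (2 <= m)%N -> periodic w \/ sturmian w -> slope w alpha ->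
  uniform_freq (letter m w) (/ (INR m + alpha)).
Proof.
move=> hm hw hs eps he; have ha := slope_bounds hs.
have hm2 : 2 <= INR m by have := INR_leq hm.
set x := / (INR m + alpha).
have hx : x * (INR m + alpha) = 1 by apply: Rinv_l; lra.
have hx0 : 0 < x by apply: Rinv_0_lt_compat; lra.
have hx1 : x <= 1 by nra.
have [C hC] := bounded_discrepancy hw.
have [K hK0 hK] := slope_discrepancy hs he.
exists (INR m + INR C + K); first by have := pos_INR C; lra.
move=> p N; have [i] := letter_wcount w p N (ltnW hm).
set B := wcount _ p N => /= -[/INR_leq h1 /INR_leq h2].
have := INR_leq (hC i 0%N B); have := INR_leq (hC 0%N i B).
have := hK B; have hBN := INR_leq (wcount_le (letter m w) p N).
rewrite -/B in hBN.
move: h1 h2; rewrite !INR_addn INR_muln => h1 h2 h3 h4 h5.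
have hB := pos_INR B.
have [h3a h3b] : - (eps * INR B + K) <= INR (wcount w 0 B) - alpha * INR B <= eps * INR B + K.
  by have := Rle_abs (INR (wcount w 0 B) - alpha * INR B);
     have := Rle_abs (- (INR (wcount w 0 B) - alpha * INR B)); rewrite Rabs_Ropp; lra.
have e : INR B - x * INR N = x * ((INR m + alpha) * INR B - INR N).
  by rewrite Rmult_minus_distr_l -Rmult_assoc hx; lra.
rewrite e Rabs_mult (Rabs_pos_eq x); last lra.
have hd : Rabs ((INR m + alpha) * INR B - INR N) <= eps * INR N + (INR m + INR C + K).
  by apply: Rabs_le; nra.
by have := Rabs_pos ((INR m + alpha) * INR B - INR N); nra.
Qed.

(** [bin_mode] replaces Stirling's formula. It involves the actual frequency [t / N], and passing to
    [x] costs a factor exponential in the deviation [D], which is at most [d N + K0]. *)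
Lemma bin_lower U x : 0 < x < 1 -> uniform_freq U x -> forall eps, 0 < eps ->
  exists2 K, 0 < K & forall N, pow (Phi x) N <= K * exp (eps * INR N) * INR 'C(N, wcount U 0 N).
Proof.
move=> hx hU eps he.
(* The two summands bound the two errors per unit of deviation: replacing [t / N] by [x] in the
   powers, and the deviation term of [Phi_term]. *)
pose k := / (x * (1 - x)) + Rabs (ln x - ln (1 - x)).
have hk0 : 0 < / (x * (1 - x)) by apply: Rinv_0_lt_compat; nra.
have hk1 := Rabs_pos (ln x - ln (1 - x)).
have hk : 0 < k by rewrite /k; lra.
pose d := eps / 2 / k.
have hd : 0 < d by rewrite /d; apply: Rdiv_lt_0_compat; lra.
have [K0 hK0 hK] := hU d hd.
have [K1 hK1 hP] := @polynomial_subexp 1 (eps / 2) ltac:(lra) ltac:(lra).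
exists (K1 * exp (k * K0)); first by apply: Rmult_lt_0_compat => //; apply: exp_pos.
move=> N; set t := wcount U 0 N; have ht : (t <= N)%N := wcount_le U 0 N.
have hdt : Rabs (INR t - x * INR N) <= d * INR N + K0 := hK 0%N N.
case: (posnP N) => [N0|N0].
  have t0 : t = 0%N by lia.
  rewrite t0 N0 bin0 /= !Rmult_0_r exp_0 !Rmult_1_r.
  have := hP 0%N; rewrite /= !Rmult_0_r exp_0.
  have : 1 <= exp (k * K0) by rewrite -exp_0; apply: exp_le; nra.
  by nra.
have hN : 0 < INR N by apply: lt_0_INR; lia.
have := INR_leq (bin_mode ht).
rewrite !(INR_muln, INR_expn) S_INR INR_subn //.
set C := INR 'C(N, t) => hmode.
have hC : 0 <= C := pos_INR _.
set D := INR t - x * INR N in hdt.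
(* [q <= p exp (q / p - 1)], applied to both factors [t / N] and [1 - t / N] *)
have ratio y z : 0 < y -> 0 <= z -> forall j, pow z j <= pow y j * exp ((z / y - 1) * INR j).
  move=> hy hz j; rewrite exp_mulnat -Rpow_mult_distr; apply: pow_incr; split=> //.
  have := exp_ineq1_le (z / y - 1); rewrite Rplus_comm => h.
  have : y * (z / y) <= y * exp (z / y - 1) by apply: Rmult_le_compat_l; lra.
  by have -> : y * (z / y) = z by field; lra.
have r1 := ratio (x * INR N) (INR t) ltac:(nra) (pos_INR _) t.
have r2 := ratio ((1 - x) * INR N) (INR N - INR t) ltac:(nra)
  ltac:(have := INR_leq ht; lra) (N - t)%N.
have hpow : pow (INR N) N <= (INR N + 1) * (C * (pow (x * INR N) t * exp ((INR t / (x * INR N) - 1) * INR t))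
    * (pow ((1 - x) * INR N) (N - t) * exp (((INR N - INR t) / ((1 - x) * INR N) - 1) * INR (N - t)))).
  apply: Rle_trans hmode _; apply: Rmult_le_compat_l; first by lra.
  apply: Rmult_le_compat => //.
  - by apply: Rmult_le_pos => //; apply: pow_le; apply: pos_INR.
  - by apply: pow_le; have := INR_leq ht; lra.
  - by apply: Rmult_le_compat_l.
have eN : pow (INR N) N = pow (INR N) t * pow (INR N) (N - t).
  by rewrite -pow_add; congr pow; lia.
(* The two exponents combine to [D^2 / (N x (1 - x))], which [|D| <= N] makes linear in [D]. *)
have hexp : (INR t / (x * INR N) - 1) * INR t + ((INR N - INR t) / ((1 - x) * INR N) - 1) * INR (N - t)
    = D * (D / INR N) * / (x * (1 - x)).
  by rewrite INR_subn // /D; field; lra.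
have hDN : Rabs (D / INR N) <= 1.
  have h1 := INR_leq ht; have h2 := pos_INR t.
  rewrite /Rdiv Rabs_mult (Rabs_pos_eq (/ INR N)); last by apply/Rlt_le/Rinv_0_lt_compat.
  rewrite -(Rinv_r (INR N)); last lra.
  apply: Rmult_le_compat_r; first by apply/Rlt_le/Rinv_0_lt_compat.
  by apply: Rabs_le; rewrite /D; nra.
have main : 1 <= (INR N + 1) * C * (pow x t * pow (1 - x) (N - t)) * exp (Rabs D * / (x * (1 - x))).
  have hNN : 0 < pow (INR N) N by apply: pow_lt.
  apply: (Rmult_le_reg_l (pow (INR N) N)) => //; rewrite Rmult_1_r.
  apply: Rle_trans hpow _; rewrite !Rpow_mult_distr.
  have -> : (INR N + 1) *
    (C * (pow x t * pow (INR N) t * exp ((INR t / (x * INR N) - 1) * INR t)) *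
    (pow (1 - x) (N - t) * pow (INR N) (N - t) *
      exp (((INR N - INR t) / ((1 - x) * INR N) - 1) * INR (N - t)))) =
    pow (INR N) N * ((INR N + 1) * C * (pow x t * pow (1 - x) (N - t)) *
      exp ((INR t / (x * INR N) - 1) * INR t +
        ((INR N - INR t) / ((1 - x) * INR N) - 1) * INR (N - t))).
    by rewrite eN exp_plus; ring.
  apply: Rmult_le_compat_l; first lra.
  apply: Rmult_le_compat_l.
    apply: Rmult_le_pos; first by apply: Rmult_le_pos; lra.
    by apply: Rmult_le_pos; apply: pow_le; lra.
  apply: exp_le; rewrite hexp; apply: Rmult_le_compat_r; first lra.
  apply: Rle_trans (Rle_abs _) _; rewrite Rabs_mult.
  by have := Rabs_pos D; nra.
have hL : 0 < pow (Phi x) N by apply: pow_lt; apply: Phi_pos.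
have step : pow (Phi x) N <= (INR N + 1) * C * exp (Rabs D * k).
  have := Rmult_le_compat_l _ _ _ (Rlt_le _ _ hL) main; rewrite Rmult_1_r => h.
  apply: Rle_trans h _.
  have -> : pow (Phi x) N * ((INR N + 1) * C * (pow x t * pow (1 - x) (N - t)) *
      exp (Rabs D * / (x * (1 - x)))) = (INR N + 1) * C *
      ((pow (Phi x) N * pow x t * pow (1 - x) (N - t)) * exp (Rabs D * / (x * (1 - x)))) by ring.
  rewrite Phi_term // -exp_plus -/D; apply: Rmult_le_compat_l; first by apply: Rmult_le_pos; lra.
  apply: exp_le; rewrite /k Rmult_plus_distr_l Rplus_comm; apply: Rplus_le_compat_l.
  by rewrite -Rabs_mult; apply: Rle_abs.
apply: Rle_trans step _.
have hE : exp (Rabs D * k) <= exp (eps / 2 * INR N) * exp (k * K0).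
  rewrite -exp_plus; apply: exp_le.
  have : Rabs D * k <= (d * INR N + K0) * k by apply: Rmult_le_compat_r; lra.
  have -> : (d * INR N + K0) * k = eps / 2 * INR N + k * K0 by rewrite /d; field; lra.
  by [].
have hP1 := hP N; rewrite Rmult_1_l in hP1.
have e2 : exp (eps * INR N) = exp (eps / 2 * INR N) * exp (eps / 2 * INR N).
  by rewrite -exp_plus; congr exp; field.
rewrite e2.
have h3 := exp_pos (eps / 2 * INR N); have h4 := exp_pos (k * K0); have h5 := exp_pos (Rabs D * k).
apply: Rle_trans (_ : K1 * exp (eps / 2 * INR N) * C * (exp (eps / 2 * INR N) * exp (k * K0)) <= _).
  apply: Rmult_le_compat => //; [by apply: Rmult_le_pos; lra | lra |].
  by apply: Rmult_le_compat_r.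
by apply: Req_le; ring.
Qed.

Lemma nroot_limit (c : nat -> nat) (l : R) : 1 < l ->
  (forall eps, 0 < eps -> exists2 K, 0 < K & forall n, (0 < n)%N -> INR (c n) <= K * exp (eps * INR n) * pow l n) ->
  (forall eps, 0 < eps -> exists2 K, 0 < K & forall n, (0 < n)%N -> pow l n <= K * exp (eps * INR n) * (INR (c n) + 1)) ->
  Un_cv (fun n => nroot n (c n)) l.
Proof.
move=> hl hup hlo eta heta.
have ll : 0 < ln l by rewrite -ln_1; apply: ln_increasing; lra.
have cont : continuity_pt exp (ln l) by apply: derivable_continuous_pt; apply: derivable_pt_exp.
have [del [hdel hcont]] := cont eta heta.
(* For large [n] the constants cost less than [eps n], so the total error in the logarithm is below
   [2 eps n]: this is less than [del n], and at most [n ln l], which forces [c n] to be positive. *)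
pose eps := Rmin (del / 3) (ln l / 2).
have he : 0 < eps by apply: Rmin_pos; lra.
have he1 : eps <= del / 3 := Rmin_l _ _.
have he2 : eps <= ln l / 2 := Rmin_r _ _.
have [K hK hu] := hup eps he; have [K' hK' hv] := hlo eps he.
have [N [hN N0]] := archimed_cor1 (Rmin eps 1 / (1 + Rabs (ln K) + Rabs (ln (2 * K'))))
   ltac:(apply: Rdiv_lt_0_compat; [apply: Rmin_pos; lra | have := Rabs_pos (ln K); have := Rabs_pos (ln (2 * K')); lra]).
exists N => n hn.
have hN0 : 0 < INR N by apply: lt_0_INR.
have hnN : INR N <= INR n by apply: le_INR.
have n0 : (0 < n)%N by lia.
have hn0 : 0 < INR n by lra.
set S := 1 + Rabs (ln K) + Rabs (ln (2 * K')) in hN.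
have hS : 1 <= S by have := Rabs_pos (ln K); have := Rabs_pos (ln (2 * K')); rewrite /S; lra.
have hSn : S < Rmin eps 1 * INR n.
  have h1 : S * / INR N < Rmin eps 1.
    have := Rmult_lt_compat_l S _ _ ltac:(lra) hN.
    by have -> : S * (Rmin eps 1 / S) = Rmin eps 1 by field; lra.
  have h2 : S < Rmin eps 1 * INR N.
    have := Rmult_lt_compat_r (INR N) _ _ hN0 h1.
    by rewrite Rmult_assoc Rinv_l; lra.
  have : 0 <= Rmin eps 1 by apply: Rmin_glb; lra.
  by nra.
have hSe : S < eps * INR n by apply: Rlt_le_trans hSn _; apply: Rmult_le_compat_r; [lra | apply: Rmin_l].
have lnK : ln K <= S by have := Rle_abs (ln K); have := Rabs_pos (ln (2 * K')); rewrite /S; lra.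
have lnK' : ln (2 * K') <= S by have := Rle_abs (ln (2 * K')); have := Rabs_pos (ln K); rewrite /S; lra.
have lnK'2 : ln K' <= ln (2 * K') by case: (Rle_lt_or_eq_dec K' (2 * K') ltac:(lra)) => [h|]; [apply/Rlt_le/ln_increasing | lra].
have hv' : exp (INR n * ln l - eps * INR n - S) <= INR (c n) + 1.
  have := hv n n0; rewrite pow_exp_ln; last lra.
  rewrite -{1}(exp_ln K') // -exp_plus => h.
  have -> : INR n * ln l - eps * INR n - S = INR n * ln l + - (eps * INR n + S) by ring.
  rewrite exp_plus exp_Ropp.
  apply: (Rmult_le_reg_r (exp (eps * INR n + S))); first exact: exp_pos.
  rewrite Rmult_assoc Rinv_l ?Rmult_1_r; last by have := exp_pos (eps * INR n + S); lra.
  apply: Rle_trans h _; rewrite Rmult_comm; apply: Rmult_le_compat_l; first by have := pos_INR (c n); lra.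
  by apply: exp_le; lra.
have cpos : (0 < c n)%N.
  case: (posnP (c n)) => // c0; move: hv'; rewrite c0 /=.
  have := exp_ineq1_le (INR n * ln l - eps * INR n - S).
  have : 0 < INR n * ln l - eps * INR n - S by nra.
  by lra.
have hc1 : 1 <= INR (c n) by apply: (INR_leq cpos).
have hc0 : 0 < INR (c n) by lra.
have up : ln (INR (c n)) <= ln K + eps * INR n + INR n * ln l.
  have := hu n n0; rewrite pow_exp_ln; last lra.
  rewrite -{1}(exp_ln K) // -!exp_plus -{1}(exp_ln (INR (c n))) // => h.
  by apply: Rnot_lt_le => /exp_increasing; lra.
have lo : INR n * ln l <= ln (2 * K') + eps * INR n + ln (INR (c n)).
  have := hv n n0; rewrite pow_exp_ln; last lra.
  move=> h; have h' : exp (INR n * ln l) <= exp (ln (2 * K') + eps * INR n + ln (INR (c n))).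
    rewrite !exp_plus !exp_ln; try lra.
    apply: Rle_trans h _; have := exp_pos (eps * INR n) => h1.
    have : 0 < K' * exp (eps * INR n) by apply: Rmult_lt_0_compat.
    by nra.
  by apply: Rnot_lt_le => /exp_increasing; lra.
have -> : nroot n (c n) = exp (/ INR n * ln (INR (c n))).
  by rewrite /nroot; case: (c n) cpos.
rewrite -{1}(exp_ln l); last lra.
set y := / INR n * ln (INR (c n)).
have hy : Rabs (y - ln l) < del.
  have e : ln (INR (c n)) = y * INR n by rewrite /y; field; lra.
  rewrite e in up lo; apply: Rabs_def1; nra.
case: (Req_dec y (ln l)) => [->|hne].
  by rewrite /Rdist Rminus_diag Rabs_R0.
apply: hcont; split; last exact: hy.
by split=> // /esym.
Qed.

End Analysis.

(** * Growth of the number of configurations *)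

Section ConfigurationGrowth.
Variables (U : nat -> bool).

(* [u] tells whether the unit may be substituted. *)
Definition upper_configs (u : bool) n : {set cfg n} :=
  [set c : cfg n | relevant U c && (u || (cn c == n))].

(** With units allowed, the condition on [cn c] provides a z followed by a nonempty even list of
    generators, as the iterated associators require. *)
Definition lower_configs (u : bool) n : {set cfg n} :=
  [set c : cfg n | [&& cz c == 1, cb c == wcount U 0 (cn c).-1
                     & if u then odd (cn c) && (1 < cn c) else cn c == n]].

Lemma counts_permc n (s : 'S_n) (c : cfg n) :
  [/\ cz (permc s c) = cz c, cn (permc s c) = cn c & cb (permc s c) = cb c].
Proof. by split; apply: count_permc. Qed.

Lemma upper_configs_perm u n (s : 'S_n) c :
  c \in upper_configs u n -> permc s c \in upper_configs u n.
Proof. by rewrite !inE /relevant; have [-> -> ->] := counts_permc s c. Qed.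

Lemma lower_configs_perm u n (s : 'S_n) c :
  c \in lower_configs u n -> permc s c \in lower_configs u n.
Proof. by rewrite !inE; have [-> -> ->] := counts_permc s c. Qed.

(** Pascal's rule splits each even term of index [n.+1] into the terms [s] and [s - 1] of the
    expansion of index [n]; since [1 <= y], the extra factor [y] in the latter does no harm. *)
Lemma even_binomial_sum (K : realFieldType) (y : K) n : (1 <= y)%R ->
  ((1 + y) ^+ n <= \sum_(s < n.+2 | ~~ odd s) 'C(n.+1, s)%:R * y ^+ s)%R.
Proof.
move=> y1; have y0 : (0 <= y)%R by apply: le_trans y1.
have -> : ((1 + y) ^+ n = \sum_(i < n.+1) 'C(n, i)%:R * y ^+ i)%R.
  by rewrite exprDn; apply: eq_bigr => i _; rewrite expr1n mul1r mulr_natl.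
have shift (f : nat -> K) : (\sum_(s < n.+2 | ~~ odd s) f s = f 0%N + \sum_(j < n.+1 | odd j) f j.+1)%R.
  rewrite big_mkcond big_ord_recl /= [in RHS]big_mkcond /=; congr (_ + _)%R.
  by apply: eq_bigr => j _; rewrite /bump /= add0n negbK.
rewrite (bigID (fun i : 'I_n.+1 => odd i)) /= addrC.
have -> : (\sum_(i < n.+1 | ~~ odd i) 'C(n, i)%:R * y ^+ i =
    \sum_(i < n.+2 | ~~ odd i) 'C(n, i)%:R * y ^+ i)%R.
  rewrite big_mkcond [RHS]big_mkcond [RHS]big_ord_recr /= bin_small // mul0r.
  by case: ifP; rewrite addr0.
rewrite (shift (fun s => 'C(n, s)%:R * y ^+ s)%R) (shift (fun s => 'C(n.+1, s)%:R * y ^+ s)%R) !bin0.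
rewrite -addrA lerD2l -big_split /=; apply: ler_sum => j _.
rewrite binS natrD mulrDl lerD2l; apply: ler_wpM2l => //.
by rewrite exprS ler_peMl // exprn_ge0.
Qed.

Local Open Scope R_scope.
Variable x : R.
Hypothesis hx : 0 < x < 1.
Hypothesis hU : uniform_freq U x.

(** Weights 1 for an allowed unit and [L x], [L (1 - x)] for b, a give total [u + L], and a word of
    the right frequency has weight close to 1. The surplus factor [q] on generators compensates the
    allowed deviation of the frequency. *)
Lemma card_upper_configs (u : bool) eps : 0 < eps -> exists2 K, 0 < K & forall n,
  INR #|upper_configs u n| <= K * exp (eps * INR n) * pow (INR u + Phi x) n.
Proof.
move=> he; pose L := Phi x; have hL : 0 < L := Phi_pos x.
pose k := Rabs (ln x - ln (1 - x)); have hk : 0 <= k := Rabs_pos _.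
(* [k] vanishes for [x = 1/2], so the denominator is [k + 1]. *)
pose d := eps / 2 / (k + 1).
have hd : 0 < d by apply: Rdiv_lt_0_compat; lra.
have hkd : k * d <= eps / 2.
  have -> : k * d = eps / 2 - d by rewrite /d; field; lra.
  lra.
have [K0 hK0 hK] := hU hd.
pose q := exp (eps / 2); have hq : 1 < q by rewrite -exp_0; apply: exp_increasing; lra.
have hq2 : exp eps = q * q by rewrite -exp_plus; congr exp; field.
have hu : 0 <= INR u := pos_INR _.
(* The weight of the z is chosen positive yet small enough that all weights together stay below
   [exp eps * (INR u + L)]. *)
pose eta := (INR u + L) * (exp eps - q).
have heta : 0 < eta by apply: Rmult_lt_0_compat; [lra | rewrite hq2; nra].
have hLq : 0 < L * q by nra.
pose wt (s : option (option bool)) : R := match s with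
  | None => INR u | Some None => eta
  | Some (Some false) => (1 - x) * (L * q) | Some (Some true) => x * (L * q) end.
have wa : 0 < (1 - x) * (L * q) by apply: Rmult_lt_0_compat; lra.
have wb : 0 < x * (L * q) by apply: Rmult_lt_0_compat; lra.
have wt0 s : (0 <= wt s)%R by apply/RleP; change (0 <= wt s); case: s => [[[]|]|] /=; lra.
(* The first entry serves configurations with a z, the other three those without z, which contain at
   most one generator. *)
pose kap := Rmin (eta * exp (- (k * K0))) (Rmin 1 (Rmin ((1 - x) * (L * q)) (x * (L * q)))).
have he0 : 0 < eta * exp (- (k * K0)) by apply: Rmult_lt_0_compat => //; apply: exp_pos.
have hkap : 0 < kap by apply: Rmin_pos => //; apply: Rmin_pos; [lra | apply: Rmin_pos].
have k1 : kap <= eta * exp (- (k * K0)) := Rmin_l _ _.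
have k2 : kap <= Rmin 1 (Rmin ((1 - x) * (L * q)) (x * (L * q))) := Rmin_r _ _.
have k3 : kap <= 1 := Rle_trans _ _ _ k2 (Rmin_l _ _).
have k4 := Rle_trans _ _ _ k2 (Rmin_r _ _).
have k5 : kap <= (1 - x) * (L * q) := Rle_trans _ _ _ k4 (Rmin_l _ _).
have k6 : kap <= x * (L * q) := Rle_trans _ _ _ k4 (Rmin_r _ _).
exists (/ kap); first exact: Rinv_0_lt_compat.
move=> n.
have sumE : (\sum_s wt s)%R = INR u + eta + L * q.
  rewrite (bigD1 None) // (bigD1 (Some None)) // (bigD1 (Some (Some true))) //.
  rewrite (bigD1 (Some (Some false))) // big_pred0 /=; last by case=> [[[]|]|].
  by rewrite addr0 -!RplusE; ring.
have hX : forall c, c \in upper_configs u n -> (kap <= \prod_i wt (c i))%R.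
  move=> c; rewrite inE => /andP[hrel hc]; apply/RleP.
  rewrite prod_weight -!RpowE -!RmultE [wt None]/= [wt (Some None)]/= [wt (Some (Some _))]/=
    [wt (Some (Some true))]/=.
  have [p1 p2] := count_parts (ext c) (iota 0 n).
  rewrite size_iota -/(cn c) -/(cb c) -/(cz c) in p1 p2.
  have -> : pow (INR u) (nu (ext c) (iota 0 n)) = 1.
    case: u hc {hu eta heta wt wt0 kap he0 hkap k1 k2 k3 k4 k5 k6 sumE} => hc; first exact: pow1.
    by have -> : nu (ext c) (iota 0 n) = 0%N by move/eqP: hc; lia.
  rewrite Rmult_1_l; move: hrel => /orP[/andP[/eqP hz hn]|/andP[/eqP hz /asboolP[p hp]]].
    rewrite hz /= Rmult_1_l.
    have [[e1 e2]|[[e1 e2]|[e1 e2]]] : (na (ext c) (iota 0 n) = 0 /\ cb c = 0)%N \/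
      ((na (ext c) (iota 0 n) = 1 /\ cb c = 0)%N \/ (na (ext c) (iota 0 n) = 0 /\ cb c = 1)%N) by lia.
    - by rewrite e1 e2 /=; lra.
    - by rewrite e1 e2 /=; lra.
    - by rewrite e1 e2 /=; lra.
  rewrite hz /= Rmult_1_r Rmult_assoc; apply: Rle_trans k1 _; apply: Rmult_le_compat_l; first lra.
  set N := (cn c).-1 in hp *.
  have hN : na (ext c) (iota 0 n) = (N - cb c)%N by rewrite /N; lia.
  have hbN : (cb c <= N)%N by rewrite /N; lia.
  rewrite hN !Rpow_mult_distr.
  have -> : pow (1 - x) (N - cb c) * (pow L (N - cb c) * pow q (N - cb c)) *
      (pow x (cb c) * (pow L (cb c) * pow q (cb c))) =
      (pow L (cb c + (N - cb c)) * pow x (cb c) * pow (1 - x) (N - cb c)) * pow q (cb c + (N - cb c)).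
    by rewrite !pow_add; ring.
  have -> : (cb c + (N - cb c))%N = N by lia.
  rewrite Phi_term // -exp_mulnat -exp_plus; apply: exp_le.
  have h1 := hK p N; rewrite -hp in h1.
  have h2 : Rabs ((INR (cb c) - x * INR N) * (ln x - ln (1 - x))) <= (d * INR N + K0) * k.
    by rewrite Rabs_mult; apply: Rmult_le_compat_r.
  have h3 := Rle_abs (- ((INR (cb c) - x * INR N) * (ln x - ln (1 - x)))).
  rewrite Rabs_Ropp in h3; have h4 := pos_INR N.
  have : k * d * INR N <= eps / 2 * INR N by apply: Rmult_le_compat_r.
  lra.
have := card_weight wt0 hX; move/RleP; rewrite -RmultE -RpowE -INRE sumE => h.
have hle : INR u + eta + L * q <= exp eps * (INR u + L).
  by rewrite /eta hq2; nra.
have h5 : pow (INR u + eta + L * q) n <= exp (eps * INR n) * pow (INR u + L) n.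
  by rewrite exp_mulnat -Rpow_mult_distr; apply: pow_incr; lra.
apply: (Rmult_le_reg_r kap) => //.
have -> : / kap * exp (eps * INR n) * pow (INR u + Phi x) n * kap =
   exp (eps * INR n) * pow (INR u + L) n by rewrite /L; field; lra.
lra.
Qed.

Lemma card_lower_configs (u : bool) eps : 0 < eps -> exists2 K, 0 < K & forall n, (0 < n)%N ->
  pow (INR u + Phi x) n <= K * exp (eps * INR n) * (INR #|lower_configs u n| + 1).
Proof.
move=> he; pose L := Phi x; have hL : 1 < L := Phi_gt1 hx.
have [K hK hB] := bin_lower hx hU he.
have mono n n' : (n' <= n)%N -> exp (eps * INR n') <= exp (eps * INR n).
  by move=> /INR_leq h; apply: exp_le; nra.
have e1 n : 1 <= exp (eps * INR n) by rewrite -exp_0; apply: exp_le; have := pos_INR n; nra.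
case: u => [|]; last first.
  exists (L * K); first by nra.
  case=> // n _; set X := lower_configs _ _.
  have : ('C(n, n) * 'C(n, wcount U 0 n) <= #|X|)%N.
    apply: leq_trans (card_pairs_lower (B := wcount U 0) (P := pred1 n) _).
      by rewrite (big_pred1 ord_max) //= => s; rewrite -val_eqE.
    move=> c hz /eqP hn hb; rewrite inE hz hb /= eqxx /=.
    have [_ p2] := count_parts (ext c) (iota 0 n.+1); rewrite -/(cz c) -/(cn c) in p2.
    by apply/eqP; lia.
  rewrite binn mul1n => /INR_leq hX.
  rewrite Rplus_0_l -/L [pow L n.+1]/=.
  have h := hB n; have h2 := mono n.+1 n (leqnSn n); have h3 := pos_INR 'C(n, wcount U 0 n).
  have h4 := exp_pos (eps * INR n).
  apply: Rle_trans (_ : L * (K * exp (eps * INR n.+1) * (INR #|X| + 1)) <= _); last by lra.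
  apply: Rmult_le_compat_l; first lra.
  apply: Rle_trans h _; apply: Rmult_le_compat; try lra; first by nra.
  by apply: Rmult_le_compat_l; lra.
have K1 : 1 <= K by have := hB 0%N; rewrite wcount0 bin0 /= Rmult_0_r exp_0; lra.
(* Of the [n.+2] variables one carries the z and one is lost to the parity restriction, leaving the
   exponent [n]. *)
exists (K * ((1 + L) * (1 + L))); first by nra.
case=> // -[|n] _.
  have := e1 1%N; have := pos_INR #|lower_configs true 1| => h1 h2.
  rewrite -/L [INR true]/= [pow _ _]/= Rmult_1_r.
  have h3 : 1 <= K * (1 + L) by nra.
  have h4 : 1 <= exp (eps * INR 1) * (INR #|lower_configs true 1| + 1) by nra.
  have -> : K * ((1 + L) * (1 + L)) * exp (eps * INR 1) * (INR #|lower_configs true 1| + 1) =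
    (1 + L) * ((K * (1 + L)) * (exp (eps * INR 1) * (INR #|lower_configs true 1| + 1))) by ring.
  by rewrite -{1}[1 + L]Rmult_1_r; apply: Rmult_le_compat_l; nra.
set X := lower_configs _ _.
pose P (s : nat) := ~~ odd s && (s != 0%N).
have hX : (\sum_(s < n.+2 | P s) 'C(n.+1, s) * 'C(s, wcount U 0 s) <= #|X|)%N.
  apply: card_pairs_lower => c hz /andP[h1 h2] hb; rewrite inE hz hb !eqxx /=.
  by move: h1 h2; case: (cn c) => [|[|m]] //=; rewrite ?negbK andbT.
pose A := K * exp (eps * INR n.+2).
have hA : 0 < A by apply: Rmult_lt_0_compat => //; apply: exp_pos.
have main : pow (1 + L) n <= A * (INR #|X| + 1).
  have y1 : (1 <= L)%R by apply/RleP; rewrite -R1E; lra.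
  have /RleP := even_binomial_sum n y1; rewrite -RpowE -RplusE -R1E => h.
  apply: Rle_trans h _; apply: Rle_trans (_ : A * INR (\sum_(s < n.+2 | ~~ odd s) 'C(n.+1, s) * 'C(s, wcount U 0 s))%N <= _).
    apply/RleP; rewrite RmultE INRE natr_sum mulr_sumr; apply: ler_sum => s _.
    rewrite natrM mulrCA; apply: ler_wpM2l => //; apply/RleP.
    rewrite -RpowE -RmultE -INRE; apply: Rle_trans (hB s) _.
    apply: Rmult_le_compat_r; first exact: pos_INR.
    by apply: Rmult_le_compat_l; [lra | apply: mono; apply: ltnW].
  apply: Rmult_le_compat_l; first lra.
  rewrite -[1]/(INR 1%N) -INR_addn; apply: INR_leq.
  (* The term [s = 0], excluded from the configurations because it gives [cn c = 1], equals 1 and is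
     paid for by the summand [+ 1]. *)
  rewrite (bigD1 ord0) //= wcount0 !bin0 muln1 addnC leq_add2r; apply: leq_trans hX.
  by rewrite (eq_bigl (fun s : 'I_n.+2 => P s)) // => s; rewrite /P -val_eqE.
rewrite -/L [INR true]/= [pow _ n.+2]/=.
have -> : K * ((1 + L) * (1 + L)) * exp (eps * INR n.+2) * (INR #|X| + 1) =
  (1 + L) * ((1 + L) * (A * (INR #|X| + 1))) by rewrite /A; ring.
by do 2!(apply: Rmult_le_compat_l; first lra).
Qed.

End ConfigurationGrowth.

(** * Exponents *)

Definition degS (dl : bool -> bool) (dz : nat -> bool) (y : sym) : bool :=
  match y with None => false | Some (inl c) => dl c | Some (inr p) => dz p end.

Section Growth.
Variables (F : fieldType) (T : eqType) (mt : T -> T -> option T).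
Variables (U : nat -> bool) (C M0 : nat).
Hypothesis few : forall n, exists s : seq (seq bool),
  size s <= C * (n + M0) /\ forall p, factor U p n \in s.

Lemma factor_lists : exists ls : nat -> seq (seq bool),
  (forall p k, factor U p k \in ls k) /\
  forall n k, k <= n -> size (ls k) <= C * (M0.+1 * n.+1).
Proof.
have /choice[ls hls] := few; exists ls; split=> [p k|n k hk]; first exact: (hls k).2.
by apply: leq_trans (hls k).1 _; rewrite leq_mul2l; apply/orP; right; nia.
Qed.

Section Limit.
Local Open Scope R_scope.
Variable x : R.
Hypothesis hx : 0 < x < 1.
Hypothesis hU : uniform_freq U x.

Lemma limit_of_configuration_bounds (u : bool) (cod : nat -> nat -> Prop) (M : nat) :
  (forall n, exists d, cod n d) ->
  (forall n d, (0 < n)%N -> cod n d ->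
     (#|lower_configs U u n| <= d)%N /\ (d <= #|upper_configs U u n| * (M * n.+1))%N) ->
  has_exp cod (Rplus (INR u) (Phi x)).
Proof.
move=> /choice[c hc] hb; exists c; split=> //.
have hL := Phi_gt1 hx; have hu : 0 <= INR u := pos_INR _.
apply: nroot_limit; first by lra.
- move=> eps he.
  have [K hK hup] := card_upper_configs hx hU u (eps := eps / 2) ltac:(lra).
  have [K' hK' hP] := @polynomial_subexp (INR M) (eps / 2) (pos_INR _) ltac:(lra).
  exists (K * K'); first by apply: Rmult_lt_0_compat.
  move=> n n0; have [_ /INR_leq] := hb n _ n0 (hc n); rewrite !INR_muln S_INR => h.
  apply: Rle_trans h _.
  have -> : eps * INR n = eps / 2 * INR n + eps / 2 * INR n by field.
  rewrite exp_plus; have h1 := hup n; have h2 := hP n; have h3 := pos_INR n.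
  have -> : K * K' * (exp (eps / 2 * INR n) * exp (eps / 2 * INR n)) * pow (INR u + Phi x) n =
    (K * exp (eps / 2 * INR n) * pow (INR u + Phi x) n) * (K' * exp (eps / 2 * INR n)) by ring.
  apply: Rmult_le_compat => //; first exact: pos_INR.
  by apply: Rmult_le_pos; [apply: pos_INR | lra].
- move=> eps he; have [K hK hlo] := card_lower_configs hx hU u he.
  exists K => // n n0; apply: Rle_trans (hlo n n0) _.
  have [/INR_leq h _] := hb n _ n0 (hc n).
  by apply: Rmult_le_compat_l; [have := exp_pos (eps * INR n); nra | lra].
Qed.

End Limit.

Lemma cn_full n (c : cfg n) : cn c = n -> forall i, i < n -> isN (ext c i).
Proof.
move=> hc i hi; have : all (fun i => isN (ext c i)) (iota 0 n).
  by rewrite all_count size_iota; apply/eqP.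
by move=> /allP; apply; rewrite mem_iota.
Qed.

Lemma all_isN_cn n sg : (forall i, i < n -> isN (sg i)) -> cn (roles n sg) = n.
Proof.
move=> h; have [_ -> _] := count_roles n sg.
apply/eqP; rewrite -[X in _ == X](size_iota 0 n) -all_count.
by apply/allP => i; rewrite mem_iota => /andP[_ /h].
Qed.

Lemma dim_mod_lower_configs u n (Q : (nat -> elem F T) -> Prop) (al : nat -> pred sym) (X : {set cfg n}) d :
  (forall p, in_Pn n p -> (is_id mt Q p <->
     forall sg, (forall i, i < n -> al i (sg i)) -> pairing (alive F U sg) p = 0%R)) ->
  X \subset lower_configs U u n ->
  (forall c, c \in X -> forall i, i < n -> al i (ext c i)) ->
  dim_mod mt n Q d -> #|X| <= d.
Proof.
move=> hid /subsetP hX hal hd.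
have hz c : c \in X -> cz c = 1 by move=> /hX; rewrite inE => /and3P[/eqP].
have hb c : c \in X -> cb c = wcount U 0 (cn c).-1 by move=> /hX; rewrite inE => /and3P[_ /eqP].
case: u hX => hX.
  apply: (dim_lower_unital hid hal hz hb _ hd) => c /hX; by rewrite inE => /and3P[].
by apply: (dim_lower_full hid hal hz hb _ hd) => c /hX; rewrite inE => /and3P[_ _ /eqP].
Qed.

Section Exponents.
Local Open Scope R_scope.
Variable x : R.
Hypothesis hx : 0 < x < 1.
Hypothesis hU : uniform_freq U x.

Lemma ordinary_growth (Q : (nat -> elem F T) -> Prop) :
  (forall n p, in_Pn n p -> (is_id mt Q p <->
     forall sg, (forall i, (i < n)%N -> isN (sg i)) -> pairing (alive F U sg) p = 0%R)) ->
  has_exp (fun n d => dim_mod mt n Q d) (Phi x).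
Proof.
move=> hid; have [ls [hls hsz]] := factor_lists.
have up n ps : indep_mod mt n Q ps -> (size ps <= #|upper_configs U false n| * (C * (M0.+1 * n.+1)))%N.
  apply: (indep_mod_upper (al := fun _ => isN) (hid n) (ls := ls)) => // [k|sg hsg hrel]; first exact: hsz.
  by rewrite inE hrel /= all_isN_cn.
rewrite -[Phi x]Rplus_0_l -[0]/(INR false).
apply: (limit_of_configuration_bounds hx hU (M := (C * M0.+1)%N)).
  by move=> n; apply: dim_mod_exists (up n).
move=> n d _ hd; split.
  apply: (dim_mod_lower_configs (al := fun _ => isN) (hid n) (subxx _) _ hd) => c.
  rewrite inE => /and3P[_ _ /eqP hc] i hi; exact: cn_full hc i hi.
by have [[ps [<- /up h]] _] := hd; rewrite -(mulnA C).
Qed.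

Variables (u : bool) (dl : bool -> bool) (dz : nat -> bool).

Definition admissible (k i : nat) (y : sym) : bool :=
  (u || isN y) && (degS dl dz y == (k <= i)%N).

Lemma degS_toS s : degS dl dz (toS s) = degc dl (dz 0%N) s.
Proof. by case: s => [[]|]. Qed.

(** A relevant configuration has at most one z, so one bit [e] records its parity, although that
    parity depends on the index and not on the role. *)
Lemma roles_degree n k sg : (forall i, (i < n)%N -> admissible k i (sg i)) ->
  relevant U (roles n sg) ->
  exists e, [forall i : 'I_n, degc dl e (roles n sg i) == (k <= i)%N].
Proof.
move=> had hrel; exists (dz (zs sg (iota 0 n))); apply/forallP => i.
have /andP[_ /eqP <-] := had i (ltn_ord i); rewrite ffunE.
case e: (sg i) => [[c|q]|] //=; rewrite (@zs_single sg (iota 0 n) i q) //; last by rewrite mem_iota /=.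
have [<- _ _] := count_roles n sg.
have [h1 _ _] := count_roles n sg.
move: hrel => /orP[/andP[/eqP h0 _]|/andP[/eqP //]].
have : (0 < nz sg (iota 0 n))%N.
  by rewrite -has_count; apply/hasP; exists (val i); rewrite ?mem_iota //= e.
by rewrite -h1 h0.
Qed.

(** Both bounds hold for each [k] with configurations of the prescribed parity pattern, and
    [sum_graded_configurations] turns the binomial sums into counts of all configurations; the two
    parities of the z double the upper count. *)
Lemma graded_growth (Q : nat -> nat -> (nat -> elem F T) -> Prop) :
  (forall n k p, (k <= n)%N -> in_Pn n p -> (is_id mt (Q k n) p <->
     forall sg, (forall i, (i < n)%N -> admissible k i (sg i)) -> pairing (alive F U sg) p = 0%R)) ->
  has_exp (fun n d => exists f : nat -> nat,
      (forall k, (k <= n)%N -> dim_mod mt n (Q k n) (f k)) /\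
      d = (\sum_(k < n.+1) 'C(n, k) * f k)%N) (Rplus (INR u) (Phi x)).
Proof.
move=> hid; have [ls [hls hsz]] := factor_lists.
pose X (P : forall n, {set cfg n}) n e (k : nat) : {set cfg n} :=
  [set c in P n | [forall i : 'I_n, degc dl e (c i) == (k <= i)%N]].
have up n k ps : (k <= n)%N -> indep_mod mt n (Q k n) ps ->
    (size ps <= (#|X (upper_configs U u) n false k| + #|X (upper_configs U u) n true k|) *
      (C * (M0.+1 * n.+1)))%N.
  move=> hk hps.
  apply: leq_trans (_ : (#|X (upper_configs U u) n false k :|: X (upper_configs U u) n true k| *
      (C * (M0.+1 * n.+1)) <= _)%N); last by rewrite leq_mul2r leq_card_setU orbT.
  have hid' p := hid n k p hk.
  apply: (indep_mod_upper (al := admissible k) hid' (ls := ls) _ _ _ hps) => // [j|sg hsg hrel]; first exact: hsz.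
  have [e he] := roles_degree hsg hrel.
  have hin : roles n sg \in X (upper_configs U u) n e k.
    rewrite inE he andbT inE hrel /=; have [//|hu] := boolP u.
    by rewrite /= all_isN_cn ?eqxx // => i /hsg; rewrite /admissible (negbTE hu) => /andP[].
  by rewrite inE; case: e hin {he} => ->; rewrite ?orbT.
apply: (limit_of_configuration_bounds hx hU (M := (2 * (C * M0.+1))%N)).
  move=> n; have /choice[f hf] : forall k, exists d, (k <= n)%N -> dim_mod mt n (Q k n) d.
    move=> k; case: (leqP k n) => hk; last by exists 0%N.
    by have [d hd] := dim_mod_exists (fun ps => up n k ps hk); exists d.
  by exists (\sum_(k < n.+1) 'C(n, k) * f k)%N, f.
move=> n _ _ [f [hf ->]]; split.
  rewrite -(sum_graded_configurations dl (@lower_configs_perm U u n) (dz 0%N)).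
  apply: leq_sum => k _; rewrite leq_mul2l; apply/orP; right.
  have hk : (k <= n)%N by rewrite -ltnS.
  have hid' p := hid n k p hk.
  apply: (dim_mod_lower_configs (al := admissible k) (u := u) hid' _ _ (hf k hk)).
    by apply/subsetP => c; rewrite inE => /andP[].
  move=> c; rewrite inE => /andP[hc /forallP hdeg] i hi.
  rewrite -[i]/(val (Ordinal hi)) /admissible extE degS_toS hdeg andbT -extE.
  by move: hc; rewrite inE => /and3P[_ _]; case: u => //= /eqP /cn_full; apply.
apply: leq_trans (_ : (\sum_(k < n.+1) ('C(n, k) * #|X (upper_configs U u) n false k| +
    'C(n, k) * #|X (upper_configs U u) n true k|) * (C * (M0.+1 * n.+1)) <= _)%N).
  apply: leq_sum => k _; rewrite -mulnDr -mulnA leq_mul2l; apply/orP; right.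
  have hk : (k <= n)%N by rewrite -ltnS.
  by have [[ps [<- /(up _ _ _ hk) h]] _] := hf k hk.
rewrite -big_distrl /= big_split /=.
rewrite !(sum_graded_configurations dl (@upper_configs_perm U u n)).
by apply: eq_leq; rewrite addnn -mul2n -!mulnA mulnCA.
Qed.

End Exponents.
End Growth.

(** * Gradings and the theorem *)

Definition graded_part (E : Type) (P0 P1 : E -> Prop) (d : bool) : E -> Prop :=
  if d then P1 else P0.

Lemma coefv1 (F : fieldType) (T : eqType) (c : F) (y x : T) :
  coefv [:: (c, y)] x = if y == x then c else 0%R.
Proof. by rewrite /coefv big_mkcond big_seq1. Qed.

Section GradedBasis.
Local Open Scope ring_scope.
Variables (F : fieldType) (T : eqType) (mt : T -> T -> option T).
Variables (P0 P1 : elem F T -> Prop).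
Hypothesis hgr : is_grading mt P0 P1.
Let Pd := graded_part P0 P1.

Lemma graded_part_mul a b u v : Pd a u -> Pd b v -> Pd (a (+) b) (mulv mt u v).
Proof.
case: hgr => _ _ _ _ [h00 h01 h10 h11].
by case: a; case: b; [exact: h11 | exact: h10 | exact: h01 | exact: h00].
Qed.

Lemma graded_part_subspace d : subspace (Pd d).
Proof. by case: hgr => h0 h1 _ _ _; case: d. Qed.

Lemma graded_part_disjoint d d' u : Pd d u -> Pd d' u -> d != d' -> is_zero u.
Proof.
case: hgr => _ _ _ h _; case: d; case: d' => // h1 h2 _; first exact: h h2 h1.
exact: h h1 h2.
Qed.

Lemma graded_part_basis d d' x : Pd d [:: (1, x)] -> Pd d' [:: (1, x)] -> d = d'.
Proof.
move=> h1 h2; apply/eqP; apply: contraT => /(graded_part_disjoint h1 h2) /(_ x) /eqP.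
by rewrite coefv1 eqxx oner_eq0.
Qed.

Lemma coefv_cat (u v : elem F T) x : coefv (u ++ v) x = coefv u x + coefv v x.
Proof. by rewrite /coefv big_cat. Qed.

Lemma coefv_scale c (u : elem F T) x : coefv (scalev c u) x = c * coefv u x.
Proof. by rewrite !coefvE pairing_scale. Qed.

(** Split [u] by the degrees of its basis vectors. The part of degree [~~ d] also equals [u] minus
    the part of degree [d], so it lies in both components and is zero. *)
Lemma graded_support d u x : (forall y, Pd d [:: (1, y)] \/ Pd (~~ d) [:: (1, y)]) ->
  Pd d u -> coefv u x != 0 -> Pd d [:: (1, x)].
Proof.
move=> hom hu; apply: contraNP => hx.
pose a (q : F * T) := `[< Pd d [:: (1, q.2)] >].
have part d' (b : pred (F * T)) : (forall q, b q -> Pd d' [:: (1, q.2)]) -> Pd d' (filter b u).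
  move=> hb; have [he h0 hD hZ] := graded_part_subspace d'.
  elim: u {hu} => [|q u IH] //=; case: (boolP (b q)) => // /hb hq.
  apply: (he (Defs.addv (scalev q.1 [:: (1, q.2)]) (filter b u))); last exact: hD (hZ _ _ hq) IH.
  move=> y; rewrite -[q :: _]cat1s /Defs.addv !coefv_cat; congr (_ + _).
  by case: q {hq} => c z; rewrite coefv_scale !coefv1; case: ifP; rewrite ?mulr1 ?mulr0.
have hua : Pd d (filter a u) by apply: part => q /asboolP.
have hub : Pd (~~ d) (filter (predC a) u).
  by apply: part => q /negP hq; case: (hom q.2) => // /asboolP.
have split_coef y : coefv u y = coefv (filter a u) y + coefv (filter (predC a) u) y.
  rewrite -coefv_cat /coefv; apply: perm_big; by rewrite perm_sym perm_filterC.
have hub' : Pd d (filter (predC a) u).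
  have [he h0 hD hZ] := graded_part_subspace d.
  apply: (he (Defs.addv u (scalev (-1) (filter a u)))); last by apply: hD => //; apply: hZ.
  by move=> y; rewrite /Defs.addv coefv_cat coefv_scale split_coef mulN1r addrAC subrr add0r.
have dd : d != ~~ d by case: (d).
rewrite split_coef (graded_part_disjoint hub' hub dd x) addr0.
rewrite /coefv big_filter_cond big_pred0 // => q.
by apply/negP => /andP[/asboolP h /eqP e]; apply: hx; rewrite -e.
Qed.

End GradedBasis.

Section Algebra.
Local Open Scope ring_scope.
Variables (F : fieldType) (m : nat) (w : nat -> bool).
Hypothesis m0 : (0 < m)%N.

Definition gen_elt (c : bool) : BA m w := exist (validb m w) (inl c) isT.
Definition z_elt (p : nat) : BA m w := exist (validb m w) (inr (zat m w p)) (zat_valid w p m0).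

(* The value at the unit is a junk one: [basisA] is only applied to non-units. *)
Definition basisA (y : sym) : BA m w :=
  match y with None => gen_elt false | Some (inl c) => gen_elt c | Some (inr p) => z_elt p end.
Definition basisS (y : sym) : option (BA m w) :=
  if y is Some _ then Some (basisA y) else None.

Lemma basisA_mul x y : isN x -> isN y ->
  mulAmw (basisA x) (basisA y) = omap basisA (mulS (letter m w) x y).
Proof.
case: x => [[c|p]|] //; case: y => [[c'|q]|] // _ _.
  rewrite /mulAmw [val (basisA _)]/= [val (basisA _)]/= zat_mul //= .
  by case: ifP => // _; apply: (valK (z_elt p.+1)).
by rewrite /mulAmw /=; case: (zat m w p).
Qed.

Lemma mulS_isN U x y r : isN x -> isN y -> mulS U x y = Some r -> isN r.
Proof.
case: x => [[c|p]|] //; case: y => [[c'|q]|] //= _ _.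
by case: ifP => // _ [<-].
Qed.

Lemma basisA_surj x : exists2 y, isN y & basisA y = x.
Proof.
case: x => [[c|[i j]] hv]; first by exists (Some (inl c)) => //; apply: val_inj.
have [p hp] := zat_surj m0 hv; exists (Some (inr p)) => //.
by apply: val_inj; rewrite /= hp.
Qed.

Lemma basisS_mul x y : mulAsharp (basisS x) (basisS y) = omap basisS (mulS (letter m w) x y).
Proof.
case: x => [x|]; case: y => [y|] //; last by case: x.
rewrite [LHS]/= (basisA_mul (x := Some x) (y := Some y)) //.
have := @mulS_isN (letter m w) (Some x) (Some y).
by case: (mulS _ _ _) => [[r|]|] //= /(_ None isT isT erefl).
Qed.

Variables (P0 P1 : elem F (BA m w) -> Prop).
Hypothesis hgr : is_grading (@mulAmw m w) P0 P1.
Let Pd := graded_part P0 P1.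
Variables (dl : bool -> bool) (d0 : bool).
Hypothesis h_dl : forall c, Pd (dl c) [:: (1, gen_elt c)].
Hypothesis h_d0 : Pd d0 [:: (1, z_elt 0)].

Fixpoint z_deg (p : nat) : bool := if p is q.+1 then z_deg q (+) dl (letter m w q) else d0.
Let deg := degS dl z_deg.

Lemma basisA_deg y : isN y -> Pd (deg y) [:: (1, basisA y)].
Proof.
case: y => [[c|p]|] // _; first exact: h_dl.
elim: p => [|p IH] //.
have := graded_part_mul hgr IH (h_dl (letter m w p)).
rewrite /mulv /= /mul_term /= mulr1.
have := basisA_mul (x := Some (inr p)) (y := Some (inl (letter m w p))) isT isT.
by rewrite /= eqxx => ->.
Qed.

Lemma deg_basisA d y : isN y -> Pd d [:: (1, basisA y)] -> deg y = d.
Proof. by move=> hy; apply: (graded_part_basis hgr); apply: basisA_deg. Qed.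

Lemma support_basisA d u x : Pd d u -> coefv u x != 0 ->
  exists2 y, isN y && (deg y == d) & basisA y = x.
Proof.
move=> hu hx; have hom z : Pd d [:: (1, z)] \/ Pd (~~ d) [:: (1, z)].
  have [y hy <-] := basisA_surj z; have := basisA_deg hy.
  by case: (deg y); case: (d); [left|right|right|left].
have hxd := graded_support hgr hom hu hx.
have [y hy e] := basisA_surj x; exists y => //; rewrite hy /=.
by apply/eqP; apply: deg_basisA => //; rewrite e.
Qed.

Lemma graded_substP n k s : graded_subst P0 P1 k n s -> forall i, (i < n)%N ->
  Pd (k <= i)%N (s i).
Proof.
move=> hs i hi; have [h1 h2] := hs i; rewrite /Pd /graded_part.
by case: (leqP k i) => hk; [apply: h2; rewrite hk | apply: h1].
Qed.

Lemma is_id_graded n k p : (k <= n)%N -> in_Pn n p ->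
  (is_id (@mulAmw m w) (graded_subst P0 P1 k n) p <->
   forall sg, (forall i, (i < n)%N -> admissible false dl z_deg k i (sg i)) ->
     pairing (alive F (letter m w) sg) p = 0).
Proof.
move=> hk.
apply: (is_id_alive (h := basisA) (dom := isN)).
- by move=> x y r hx hy; apply: mulS_isN.
- exact: basisA_mul.
- by move=> i y /andP[].
- by move=> s hs i hi x hx; apply: support_basisA (graded_substP hs hi) hx.
- move=> sg hsg i; split=> hi.
    have /andP[hN /eqP hd] := hsg i (leq_trans hi hk).
    by have := basisA_deg hN; rewrite /deg hd leqNgt hi.
  have /andP[h1 h2] := hi; have /andP[hN /eqP hd] := hsg i h2.
  by have := basisA_deg hN; rewrite /deg hd h1.
Qed.

Lemma is_id_ordinary n p : in_Pn n p ->
  (is_id (@mulAmw m w) (fun _ : nat -> elem F (BA m w) => True) p <->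
   forall sg, (forall i, (i < n)%N -> isN (sg i)) -> pairing (alive F (letter m w) sg) p = 0).
Proof.
apply: (is_id_alive (h := basisA) (dom := isN) (al := fun _ => isN)) => //.
- by move=> x y r hx hy; apply: mulS_isN.
- exact: basisA_mul.
- by move=> s _ i _ x _; have [y hy <-] := basisA_surj x; exists y.
Qed.

Lemma coefv_embed (u : elem F (BA m w)) x :
  coefv (embedA u) x = if x is Some y then coefv u y else 0.
Proof.
rewrite /coefv /embedA big_map; case: x => [y|]; last by rewrite big_pred0.
by apply: eq_bigl.
Qed.

Lemma is_id_sharp n k p : (k <= n)%N -> in_Pn n p ->
  (is_id (@mulAsharp m w) (graded_subst (gradeS0 P0) (gradeS1 P1) k n) p <->
   forall sg, (forall i, (i < n)%N -> admissible true dl z_deg k i (sg i)) ->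
     pairing (alive F (letter m w) sg) p = 0).
Proof.
move=> hk; have [_ P00 _ _] := graded_part_subspace hgr false.
have supp d u x : Pd d u -> coefv u x != 0 -> exists2 y, deg y = d & basisS y = Some x.
  move=> hu hx; have [y /andP[hy /eqP hd] <-] := support_basisA hu hx.
  by exists y => //; case: y hy {hd}.
apply: (is_id_alive (h := basisS) (dom := predT)) => //.
- by move=> x y _ _; apply: basisS_mul.
- move=> s hs i hi x; have [h1 h2] := hs i; rewrite /admissible /=.
  case: (leqP k i) => hki.
    have [|u [hu e]] := h2 _; first by rewrite hki.
    rewrite e coefv_embed; case: x => [x|]; last by rewrite eqxx.
    by move=> /(supp true _ _ hu)[y hy <-]; exists y; rewrite // -/deg hy.
  have [u [c [hu e]]] := h1 hki.
  rewrite e coefv_cat coefv_embed; case: x => [x|]; last by exists None.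
  rewrite coefv1 addr0.
  by move=> /(supp false _ _ hu)[y hy <-]; exists y; rewrite // -/deg hy.
- move=> sg hsg i; split=> hi.
    have /eqP := hsg i (leq_trans hi hk); rewrite -/deg leqNgt hi /=.
    (* The unit lies in the even component with zero part in the algebra and scalar 1; any other
       even basis vector has scalar 0. *)
    case e: (sg i) => [y|] hd; last by exists [::], 1; split.
    exists [:: (1, basisA (Some y))], 0; split; first by have := @basisA_deg (Some y) isT; rewrite hd.
    by move=> x; rewrite coefv_cat !coefv1; case: ifP => _; rewrite ?if_same addr0.
  have /andP[h1 h2] := hi; have /eqP := hsg i h2; rewrite -/deg h1 /=.
  case e: (sg i) => [y|] // hd.
  by exists [:: (1, basisA (Some y))]; split=> //; have := @basisA_deg (Some y) isT; rewrite hd.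
Qed.

End Algebra.

Theorem theorem5 (F : fieldType) (hF : [pchar F]%R =i pred0)
  (m : nat) (hm : (2 <= m)%N) (w : nat -> bool) (alpha : R)
  (hw : periodic w \/ sturmian w) (hslope : slope w alpha)
  (P0 P1 : elem F (BA m w) -> Prop)
  (hgr : is_grading (@mulAmw m w) P0 P1)
  (ha : homogeneous P0 P1 (gen_a F m w))
  (hb : homogeneous P0 P1 (gen_b F m w))
  (hz : homogeneous P0 P1 (gen_z F m w)) :
  let L := Phi (Rinv (Rplus (INR m) alpha)) in
  [/\ has_exp (gcodim (@mulAmw m w) P0 P1) L,
      has_exp (codim F (@mulAmw m w)) L &
      has_exp (gcodim (@mulAsharp m w) (gradeS0 P0) (gradeS1 P1)) (Rplus L 1)].
Proof.
move=> L; have m0 : (0 < m)%N := ltnW hm.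
have hom u : homogeneous P0 P1 u -> exists d, graded_part P0 P1 d u.
  by case=> h; [exists false | exists true].
have genE c : basis_elem F m w (inl c) = [:: (1%R, gen_elt m w c)].
  by rewrite /basis_elem; have -> : insub (inl c : rawB) = Some (gen_elt m w c) := valK (gen_elt m w c).
have zE : gen_z F m w = [:: (1%R, z_elt w m0 0)].
  by rewrite /gen_z /basis_elem;
     have -> : insub (inr (1, 1)%N : rawB) = Some (z_elt w m0 0) := valK (z_elt w m0 0).
have [da hda] := hom _ ha; have [db hdb] := hom _ hb; have [d0 hd0] := hom _ hz.
rewrite /gen_a /gen_b !genE in hda hdb; rewrite zE in hd0.
pose dl c := if c then db else da.
have hdl c : graded_part P0 P1 (dl c) [:: (1%R, gen_elt m w c)] by case: c.
have hfreq := letter_freq hm hw hslope.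
have [C few] := letter_few_factors m0 hw.
have hx : Rlt 0 (Rinv (Rplus (INR m) alpha)) /\ Rlt (Rinv (Rplus (INR m) alpha)) 1.
  have ha01 := slope_bounds hslope; have hm2 := INR_leq hm; rewrite /= in hm2.
  split; first by apply: Rinv_0_lt_compat; lra.
  by rewrite -Rinv_1; apply: Rinv_0_lt_contravar; lra.
split.
- rewrite -[L]Rplus_0_l -[IZR 0]/(INR false).
  apply: (graded_growth few hx hfreq (dl := dl) (dz := z_deg m w dl d0)
    (Q := fun k n => graded_subst P0 P1 k n)) => n k p.
  exact: (is_id_graded hgr hdl hd0).
- by apply: (ordinary_growth few hx hfreq (Q := fun=> True)) => n p; apply: is_id_ordinary m0 _ _.
- rewrite Rplus_comm -[IZR 1]/(INR true).
  apply: (graded_growth few hx hfreq (dl := dl) (dz := z_deg m w dl d0)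
    (Q := fun k n => graded_subst (gradeS0 P0) (gradeS1 P1) k n)) => n k p.
  exact: (is_id_sharp hgr hdl hd0).
Qed.
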